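(* For $k\ge1$, $\ell\ge1$ and $\mu\in\mathrm{Par}^k_\ell$, $$s^{(k)}_\mu=\sum_{T\in\mathrm{VSMT}^{k+1}_{(\ell)}(\mu+1^\ell)}t^{\mathrm{spin}(T)}\,s^{(k+1)}_{\mathrm{inside}(T)},$$ where $1^\ell=(1,\dots,1)\in\mathbb Z^\ell$.
   Context: $\mathrm{Par}^k_\ell=\{\mu\in\mathbb Z^\ell:k\ge\mu_1\ge\dots\ge\mu_\ell\ge0\}$; $\mathrm{Par}^k$ is the set of partitions with largest part $\le k$; partitions are identified with themselves padded by zeros. Hook length of a box (English notation): number of boxes below it in its column plus those weakly to its right in its row. For $K\ge1$, a $(K+1)$-core is a partition with no box of hook length $K+1$; $\mathfrak p(\kappa)$ has $r$-th part equal to the number of boxes in row $r$ of $\kappa$ with hook length $\le K$, a bijection from $(K+1)$-cores to $\mathrm{Par}^K$. A strong cover $\tau\Rightarrow\kappa$: $(K+1)$-cores with $\tau\subset\kappa$, $|\mathfrak p(\tau)|+1=|\mathfrak p(\kappa)|$; a strong marked cover $\tau\xRightarrow{r}\kappa$ adds a positive integer $r$ equal to the smallest row index of some connected component of $\kappa/\tau$; its spin is $c(h-1)+N$ with $c$ the number of components of $\kappa/\tau$, $h$ the common number of rows of each component, $N$ the number of components entirely in rows $>r$. For $\eta\in\mathbb Z^\infty_{\ge0}$, $m=|\eta|<\infty$, a strong marked tableau (resp. vertical strong marked tableau) of weight $\eta$ is a chain $T=(\kappa^{(0)}\xRightarrow{r_1}\cdots\xRightarrow{r_m}\kappa^{(m)})$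 of strong marked covers with $r_{v_i+1}\ge\dots\ge r_{v_i+\eta_i}$ (resp. $r_{v_i+1}<\dots<r_{v_i+\eta_i}$) for all $i$, where $v_i=\eta_1+\dots+\eta_{i-1}$; $\mathrm{spin}(T)$ is the sum of spins, $\mathrm{inside}(T)=\mathfrak p(\kappa^{(0)})$; $\mathrm{SMT}^K_\eta(\mu)$ (resp. $\mathrm{VSMT}^K_\eta(\mu)$) is the set of those with $\mathfrak p(\kappa^{(m)})=\mu$. The $K$-Schur function is $s^{(K)}_\mu(x;t)=\sum_{\eta\in\mathbb Z^\infty_{\ge0},\,|\eta|=|\mu|}\sum_{T\in\mathrm{SMT}^K_\eta(\mu)}t^{\mathrm{spin}(T)}x^\eta$. *)

(* Defs.v *)
From mathcomp Require Import all_boot all_order all_algebra.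
From mathcomp Require Import finmap.
From mathcomp Require Import boolp classical_sets functions fsbigop.

Set Implicit Arguments.
Unset Strict Implicit.
Unset Printing Implicit Defensive.

Import GRing.Theory.

(* Rows and columns, hence also marks and the variables x_i, are numbered
   from 0.  A box is a pair (row, column), in English notation. *)

Definition is_part (s : seq nat) : bool := sorted geq s && (0 \notin s).

(* [Par k l s]: s belongs to Par^k_l; trailing zeros are kept. *)
Definition Par (k l : nat) (s : seq nat) : bool :=
  [&& size s == l, all (fun x => x <= k) s & sorted geq s].

(* Equality up to padding by zeros. *)
Definition eq_pad (s t : seq nat) : Prop := nth 0 s =1 nth 0 t.

Definition diagram (s : seq nat) : {fset nat * nat} :=
  [fset b in [seq (r, c) | r <- iota 0 (size s), c <- iota 0 (nth 0 s r)]]%fset.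

Definition hook (s : seq nat) (b : nat * nat) : nat :=
  #|` [fset d in diagram s | (b.1 < d.1) && (d.2 == b.2)]%fset| +
  #|` [fset d in diagram s | (d.1 == b.1) && (b.2 <= d.2)]%fset|.

Definition is_core (n : nat) (s : seq nat) : Prop :=
  is_part s /\ forall b, b \in diagram s -> hook s b != n.

(* The map \mathfrak{p} from (K+1)-cores to Par^K. *)
Definition pcore (K : nat) (s : seq nat) : seq nat :=
  [seq #|` [fset b in diagram s | (b.1 == r) && (hook s b <= K)]%fset|
     | r <- iota 0 (size s)].

Section SkewComponents.
Variables tau kappa : seq nat.

Definition skew : {fset nat * nat} := (diagram kappa `\` diagram tau)%fset.

Definition adjacent : rel skew := fun b d =>
  let: (r, c) := val b in let: (r', c') := val d in
  ((r == r') && ((c == c'.+1) || (c' == c.+1))) ||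
  ((c == c') && ((r == r'.+1) || (r' == r.+1))).

Definition components : {set {set skew}} :=
  equivalence_partition (connect adjacent) [set: skew]%SET.

Definition rows (C : {set skew}) : seq nat :=
  undup [seq (val b).1 | b <- enum C].

Definition is_first_row (r : nat) (C : {set skew}) : bool :=
  (r \in rows C) && all (fun r' => r <= r') (rows C).

(* For a strong cover all components have the same number of rows; this common
   value is extracted as a maximum. *)
Definition ribbon_height : nat := \max_(C in components) size (rows C).

Definition cover_spin (r : nat) : nat :=
  #|components| * (ribbon_height - 1) +
  #|[set C in components | all (fun r' => r < r') (rows C)]%SET|.

End SkewComponents.

Definition strong_cover (K : nat) (tau kappa : seq nat) : Prop :=
  [/\ is_core K.+1 tau, is_core K.+1 kappa,
      (diagram tau `<=` diagram kappa)%fset &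
      (sumn (pcore K tau)).+1 = sumn (pcore K kappa)].

Definition strong_marked_cover (K : nat) (tau : seq nat) (r : nat)
    (kappa : seq nat) : Prop :=
  strong_cover K tau kappa /\
  exists2 C, C \in components tau kappa & is_first_row r C.

(* The chain kappa0 =r1=> kappa1 =r2=> ... =rm=> kappam is encoded by
   (kappa0, [:: (r1, kappa1); ...; (rm, kappam)]). *)
Definition chain : Type := (seq nat * seq (nat * seq nat))%type.

Fixpoint strong_chain_from (K : nat) (tau : seq nat)
    (st : seq (nat * seq nat)) : Prop :=
  if st is (r, kappa) :: st' then
    strong_marked_cover K tau r kappa /\ strong_chain_from K kappa st'
  else True.

Definition strong_chain (K : nat) (T : chain) : Prop :=
  is_core K.+1 T.1 /\ strong_chain_from K T.1 T.2.

Definition chain_end (T : chain) : seq nat := last T.1 (unzip2 T.2).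

Definition marks (T : chain) : seq nat := unzip1 T.2.

Fixpoint spin_from (tau : seq nat) (st : seq (nat * seq nat)) : nat :=
  if st is (r, kappa) :: st' then
    cover_spin tau kappa r + spin_from kappa st'
  else 0.

Definition spin (T : chain) : nat := spin_from T.1 T.2.

Definition inside (K : nat) (T : chain) : seq nat := pcore K T.1.

(* Finitely supported sequences: weights of tableaux, exponents of monomials. *)
Notation weight := {fsfun nat -> nat with 0}.

Definition wsize (eta : weight) : nat := \sum_(i <- finsupp eta) eta i.

Definition single_weight (l : nat) : weight :=
  [fsfun i in [fset 0]%fset => l | 0].

(* The i-th block r_{v_i+1}, ..., r_{v_i+eta_i} of marks. *)
Definition mark_block (eta : weight) (T : chain) (i : nat) : seq nat :=
  take (eta i) (drop (\sum_(j < i) eta j) (marks T)).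

(* [ord] is the relation imposed on consecutive marks within a block. *)
Definition marked_tableaux (ord : rel nat) (K : nat) (eta : weight)
    (mu : seq nat) : set chain :=
  [set T | [/\ strong_chain K T,
               size (marks T) = wsize eta,
               (forall i, sorted ord (mark_block eta T i)) &
               eq_pad (pcore K (chain_end T)) mu]]%classic.

Definition SMT := marked_tableaux geq.
Definition VSMT := marked_tableaux ltn.

Local Open Scope ring_scope.

(* Formal power series over Z[t] in x_0, x_1, ..., given by their coefficients;
   'X : {poly int} is the parameter t.  The regular module {poly int}^o makes
   [power_series] a module over Z[t], with pointwise operations. *)
Definition power_series : Type := weight -> {poly int}^o.

(* The set SMT K eta mu is finite, as are the sets VSMT K eta mu: every core in
   a chain is contained in the last one, which mu determines.  So sums
   \sum_(T \in _) over them are sums over all their elements. *)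
Definition kSchur (K : nat) (mu : seq nat) : power_series := fun eta =>
  if wsize eta == sumn mu then
    \sum_(T \in SMT K eta mu) ('X^(spin T) : {poly int})
  else 0.

(* Main.v *)
(* Write n = k + 1 and let the bounded partition mu encode the n-core whose rows
   satisfy kappa_r = mu_r + kappa_(down r), down r = r + n - mu_r.

   The Catalan function H(Psi; g) = prod_(b in Psi) (1 - t R_b)^-1 s_g is only
   seen through linear functionals g |-> phi g on integer weights which are
   antisymmetric under the dot action of (almost all) simple reflections; t is
   made nilpotent so that the geometric series are finite.  For the root set
   {(i, j) : i + n - g_i <= j} the functional g |-> H(Psi_g; g) satisfies a
   straightening rule when g_(p+1) = g_p + 1: it vanishes, or moves one unit up
   the bounce path at the price of one factor t.  Iterating it on mu - e_y one
   climbs the bounce path of y, and obtains 0 or t^(c(h-1)) times the value at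
   the bounded partition of a core tau, kappa/tau being made of c ribbons of
   height h; all strong covers of kappa are of this kind.  Together with
   H(Psi_mu; mu - e_z) = H(mu - e_z) + t H(Psi_mu; mu - e_(down z)) this is the
   dual vertical Pieri rule, one marked cover at a time.

   Passing from (k, mu) to (k + 1, mu + 1^l) does not change the root set and
   translates the weight by 1^l, which is what removing a vertical strip of size
   l does.  This gives the theorem for chains with increasing or unconstrained
   consecutive marks, hence for strong marked tableaux, because "weakly
   decreasing" is the complement of "increasing". *)

Require Import Defs.
From mathcomp Require Import all_boot all_order all_algebra.
From mathcomp Require Import finmap.
From mathcomp Require Import boolp classical_sets functions fsbigop.
From mathcomp Require Import perm qpoly zify ring.

Set Implicit Arguments.
Unset Strict Implicit.
Unset Printing Implicit Defensive.
Import Order.TTheory GRing.Theory Num.Theory.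

(** * Catalan operators *)

Local Open Scope ring_scope.

(** The functional carrying the remaining marks, [peel cs z], remembers that the next mark must be
    smaller than z. This does no harm because only rows y on the bounce path of z are ever lowered:
    the straightenings made while climbing from y happen at the inner rows of blocks that start on
    this path, and z is never such an inner row. A second difficulty is that the algebra only
    produces ladders, whereas a strong cover is defined by containment and a difference of sizes.
    That no strong cover is missed is proved on the abacus: for distinct nested cores tau and kappa
    there is a ladder cover of kappa whose inner core still contains tau. Hence the size of the
    bounded partition grows strictly along containment, and a difference of one leaves no room
    between tau and that inner core. *)

Definition eps (i : nat) : nat -> int := fun x => (x == i)%:Z.

Definition root (b : nat * nat) : nat -> int := fun x => eps b.1 x - eps b.2 x.

Definition lower (g : nat -> int) (z : nat) : nat -> int := fun x => g x - eps z x.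

Definition raise (g : nat -> int) (b : nat * nat) : nat -> int :=
  fun x => g x + root b x.

Section Raising.
Variables (R : comNzRingType) (t : R) (B : nat).
Hypothesis tB : t ^+ B = 0.
Hypothesis no2 : forall x : R, x + x = 0 -> x = 0.
Implicit Types (phi psi : (nat -> int) -> R) (g : nat -> int) (s : seq (nat * nat)).

Definition geom (b : nat * nat) phi : (nat -> int) -> R := fun g =>
  \sum_(m < B) t ^+ m * phi (fun x => g x + m%:Z * root b x).

Definition catalan s phi : (nat -> int) -> R := foldr geom phi s.

Lemma geom_rec b phi g : geom b phi g = phi g + t * geom b phi (raise g b).
Proof.
rewrite /geom; case: B tB => [|n] tn.
  by move: (oner_neq0 R); rewrite -[1]/(t ^+ 0) tn eqxx.
rewrite big_ord_recl expr0 mul1r.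
congr (_ + _); first by congr phi; apply/funext => x /=; ring.
rewrite mulr_sumr [in RHS]big_ord_recr /= mulrA -exprS tn mul0r addr0.
apply: eq_bigr => i _; rewrite mulrA -exprS; congr (_ * phi _).
by apply/funext => x; rewrite /raise /bump /= ; ring.
Qed.

Lemma geomC b c phi : geom b (geom c phi) = geom c (geom b phi).
Proof.
apply/funext => g; rewrite /geom.
under eq_bigr do rewrite mulr_sumr.
rewrite exchange_big /=; apply: eq_bigr => i _.
rewrite mulr_sumr; apply: eq_bigr => j _; rewrite !mulrA [t ^+ _ * _]mulrC.
by congr (_ * phi _); apply/funext => x; ring.
Qed.

Lemma catalan_cat s1 s2 phi : catalan (s1 ++ s2) phi = catalan s1 (catalan s2 phi).
Proof. exact: foldr_cat. Qed.

Lemma catalan_geom s b phi : catalan s (geom b phi) = geom b (catalan s phi).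
Proof. by elim: s => //= c s ->; rewrite geomC. Qed.

Lemma catalan_perm s1 s2 phi : perm_eq s1 s2 -> catalan s1 phi = catalan s2 phi.
Proof.
elim: s1 s2 => [|b s1 IH] s2 H; first by move: H; rewrite perm_sym => /perm_nilP ->.
have /perm_mem /(_ b) := H; rewrite mem_head => /esym bs2.
move: H; case/splitPr: bs2 => p1 p2.
rewrite perm_sym perm_catC /= perm_cons perm_catC perm_sym => /IH /= ->.
by rewrite !catalan_cat /= -catalan_geom.
Qed.

Lemma catalan_rec s s' b phi g : perm_eq s (b :: s') ->
  catalan s phi g = catalan s' phi g + t * catalan s phi (raise g b).
Proof. by move=> /catalan_perm ->; rewrite /= geom_rec. Qed.

(** The dot action s_p (g + rho) - rho with rho_x = -x. Its fixed weights are those with g (p + 1) =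
    g p + 1. *)
Definition dot (p : nat) g : nat -> int := fun x =>
  if x == p then g p.+1 - 1 else if x == p.+1 then g p + 1 else g x.

Definition swap (p x : nat) : nat :=
  if x == p then p.+1 else if x == p.+1 then p else x.

Lemma swapK p : involutive (swap p).
Proof. by move=> x; rewrite /swap; repeat case: eqP => //; lia. Qed.

Definition anti p phi := forall g, phi (dot p g) = - phi g.

(** The dot action is affine with linear part the transposition of p and p + 1, so it turns each
    raising operator into the one for the transposed root. *)
Lemma catalan_dot p s phi g : catalan s phi (dot p g) =
  catalan [seq (swap p b.1, swap p b.2) | b <- s] (fun h => phi (dot p h)) g.
Proof.
elim: s g => //= b s IH g; rewrite /geom; apply: eq_bigr => m _.
rewrite -IH; congr (_ * catalan _ _ _); apply/funext => x.
rewrite /dot /root /eps /swap /=.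
have [->|xp] := eqVneq x p; last have [->|xp1] := eqVneq x p.+1.
- have -> : (p.+1 == (if b.1 == p then p.+1 else if b.1 == p.+1 then p else b.1)) = (p == b.1).
    by repeat case: eqP; lia.
  have -> : (p.+1 == (if b.2 == p then p.+1 else if b.2 == p.+1 then p else b.2)) = (p == b.2).
    by repeat case: eqP; lia.
  by ring.
- have -> : (p == (if b.1 == p then p.+1 else if b.1 == p.+1 then p else b.1)) = (p.+1 == b.1).
    by repeat case: eqP; lia.
  have -> : (p == (if b.2 == p then p.+1 else if b.2 == p.+1 then p else b.2)) = (p.+1 == b.2).
    by repeat case: eqP; lia.
  by ring.
- have -> : (x == (if b.1 == p then p.+1 else if b.1 == p.+1 then p else b.1)) = (x == b.1).
    by repeat case: eqP => //; move: xp xp1; lia.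
  have -> : (x == (if b.2 == p then p.+1 else if b.2 == p.+1 then p else b.2)) = (x == b.2).
    by repeat case: eqP => //; move: xp xp1; lia.
  by [].
Qed.

Lemma catalanN s phi g : catalan s (fun h => - phi h) g = - catalan s phi g.
Proof.
elim: s g => //= b s IH g; rewrite /geom -sumrN; apply: eq_bigr => m _.
by rewrite IH mulrN.
Qed.

(** [g] is fixed by the dot action and the roots are symmetric, so the value equals its own
    opposite; [no2] then makes it 0. *)
Lemma catalan_anti0 p s phi g : anti p phi ->
  perm_eq [seq (swap p b.1, swap p b.2) | b <- s] s ->
  g p.+1 = g p + 1 -> catalan s phi g = 0.
Proof.
move=> aphi ss gp; apply: no2.
have {1}-> : g = dot p g.
  by apply/funext => x; rewrite /dot; case: eqP => [->|_]; [lia|case: eqP => [->|//]; lia].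
rewrite catalan_dot (catalan_perm _ ss).
have -> : (fun h => phi (dot p h)) = (fun h => - phi h) by apply/funext => h; exact: aphi.
by rewrite catalanN addNr.
Qed.

Section Straightening.
Variables (l n : nat).

Definition pairs : seq (nat * nat) := [seq (i, j) | i <- iota 0 l, j <- iota 0 l].

Definition roots g : seq (nat * nat) :=
  [seq b <- pairs | b.1%:Z + n%:Z - g b.1 <= b.2%:Z].

Definition kcat phi g : R := catalan (roots g) phi g.

Lemma mem_pairs i j : ((i, j) \in pairs) = (i < l)%N && (j < l)%N.
Proof.
apply/allpairsP/andP => [[[a b] []]|[il jl]].
  by rewrite !mem_iota /= => al bl [-> ->].
by exists (i, j); rewrite !mem_iota.
Qed.

Lemma pairs_uniq : uniq pairs.
Proof. by apply: allpairs_uniq; rewrite ?iota_uniq // => -[a b] [c d]. Qed.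

Lemma filter_pairs_cons (P Q : pred (nat * nat)) i j :
  (i < l)%N -> (j < l)%N -> ~~ Q (i, j) ->
  (forall a b, (a < l)%N -> (b < l)%N -> P (a, b) = ((a, b) == (i, j)) || Q (a, b)) ->
  perm_eq [seq b <- pairs | P b] ((i, j) :: [seq b <- pairs | Q b]).
Proof.
move=> il jl nQ PQ; apply: uniq_perm; rewrite /= ?filter_uniq ?pairs_uniq //.
  by rewrite mem_filter (negbTE nQ).
case=> a b; rewrite inE !mem_filter mem_pairs.
have [/andP[al bl]|nl] := boolP ((a < l) && (b < l))%N; first by rewrite PQ // !andbT.
by rewrite !andbF orbF; apply/esym/eqP => -[ai bj]; rewrite ai bj il jl in nl.
Qed.

Lemma catalan_swap0 (P : pred (nat * nat)) p phi g :
  anti p phi -> (p.+1 < l)%N ->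
  (forall i j, (i < l)%N -> (j < l)%N -> P (swap p i, swap p j) = P (i, j)) ->
  g p.+1 = g p + 1 -> catalan [seq b <- pairs | P b] phi g = 0.
Proof.
move=> aphi pl sP gp; apply: (catalan_anti0 aphi) => //.
have sl x : (swap p x < l)%N = (x < l)%N by rewrite /swap; repeat case: eqP; lia.
apply: uniq_perm; rewrite ?filter_uniq ?pairs_uniq //.
  rewrite map_inj_in_uniq ?filter_uniq ?pairs_uniq // => -[a b] [c d] _ _ /= [].
  by move=> /(can_inj (swapK p)) -> /(can_inj (swapK p)) ->.
case=> a b; apply/mapP/idP => [[[c d]]|].
  by rewrite !mem_filter !mem_pairs => /and3P[Pcd cl dl] [-> ->]; rewrite sP ?sl ?Pcd ?cl.
rewrite mem_filter mem_pairs => /and3P[Pab al bl].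
exists (swap p a, swap p b); last by rewrite /= !swapK.
by rewrite mem_filter mem_pairs !sl sP ?Pab ?al.
Qed.

(** Rows p and p + 1 have the same leftmost root because g (p + 1) = g p + 1, and columns p and p +
    1 contain the same roots because no row starts in column p + 1. So the root set is symmetric. *)
Lemma kcat0 p phi g : anti p phi -> (p.+1 < l)%N -> g p.+1 = g p + 1 ->
  (forall i, (i < l)%N -> i%:Z + n%:Z - g i <> p.+1%:Z) -> kcat phi g = 0.
Proof.
move=> aphi pl gp nf; apply: (catalan_swap0 aphi pl) => // i j il jl /=.
have fi := nf _ il; rewrite /swap.
by repeat case: eqP => ?; subst; lia.
Qed.

(* Adding (u, p) and then removing the leftmost root of row p + 1 costs
   nothing, as the correction terms are killed by the symmetry exchanging p
   and p + 1. *)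
Lemma kcat_straighten p u phi g : anti p phi -> (p.+1 < l)%N -> g p.+1 = g p + 1 ->
  p.+1%:Z < p%:Z + n%:Z - g p -> (u < l)%N -> u%:Z + n%:Z - g u = p.+1%:Z ->
  (forall i, (i < l)%N -> i%:Z + n%:Z - g i = p.+1%:Z -> i = u) ->
  kcat phi g = t * kcat phi (raise g (u, p.+1)).
Proof.
move=> aphi pl gp fp ul fu uniqu.
have up : u <> p by move=> E; subst; lia.
have up1 : u <> p.+1 by move=> E; subst; lia.
pose P : pred (nat * nat) := fun b => b.1%:Z + n%:Z - g b.1 <= b.2%:Z.
(* Row u is the only one in which columns p and p + 1 differ. Dropping (u, p + 1), as in [P0], or
   adding (u, p), as in [P1], repairs this, so both sets are symmetric. *)
pose P0 : pred (nat * nat) := fun b => P b && (b != (u, p.+1)).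
pose P1 : pred (nat * nat) := fun b => P b || (b == (u, p)).
have fl i : (i < l)%N -> i <> u -> i%:Z + n%:Z - g i <> p.+1%:Z.
  by move=> il iu /(uniqu _ il).
rewrite /kcat (@catalan_rec _ [seq b <- pairs | P0 b] (u, p.+1)); last first.
  apply: filter_pairs_cons => //; first by rewrite /P0 eqxx andbF.
  move=> a b al bl; rewrite /P0; case: eqP => [[-> ->]|_] /=; last by rewrite andbT.
  by rewrite /P /=; lia.
rewrite (catalan_swap0 aphi) // ?add0r; last first.
  move=> i j il jl; rewrite /P0 /P /= !xpair_eqE.
  have [->|/eqP iu] := eqVneq i u.
    have -> : swap p u = u by rewrite /swap; do 2 case: eqP => //.
    by rewrite !eqxx /= /swap; repeat case: eqP => ?; subst; lia.
  have fi := fl _ il iu.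
  have -> : (swap p i == u) = false by rewrite /swap; repeat case: eqP; lia.
  by rewrite /= /swap; repeat case: eqP => ?; subst; lia.
congr (_ * _); set g' := raise g (u, p.+1).
have g'p : g' p = g p by rewrite /g' /raise /root /eps /=; lia.
have g'p1 : g' p.+1 = g p by rewrite /g' /raise /root /eps /=; lia.
have g'u : g' u = g u + 1 by rewrite /g' /raise /root /eps /=; lia.
have g'x x : x <> u -> x <> p.+1 -> g' x = g x.
  by move=> ? ?; rewrite /g' /raise /root /eps /=; lia.
have sP1 i j : (i < l)%N -> (j < l)%N -> P1 (swap p i, swap p j) = P1 (i, j).
  move=> il jl; rewrite /P1 /P /= !xpair_eqE.
  have [->|/eqP iu] := eqVneq i u.
    have -> : swap p u = u by rewrite /swap; do 2 case: eqP => //.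
    by rewrite !eqxx /= /swap; repeat case: eqP => ?; subst; lia.
  have fi := fl _ il iu.
  have -> : (swap p i == u) = false by rewrite /swap; repeat case: eqP; lia.
  by rewrite /= /swap; repeat case: eqP => ?; subst; lia.
have E1 : catalan [seq b <- pairs | P1 b] phi g' = catalan (roots g) phi g'.
  rewrite (@catalan_rec _ (roots g) (u, p)); last first.
    apply: filter_pairs_cons; [by []|by apply: ltnW| |].
    - by rewrite /=; lia.
    - by move=> a b al bl; rewrite /P1 orbC.
  rewrite (catalan_swap0 aphi) ?mulr0 ?addr0 //.
  by rewrite /raise /root /eps /= -/g'; lia.
rewrite -E1.
(* Row p + 1 of [roots g'] starts one column later than in [roots g]; there is a root to remove only
   if the old start j lies inside the l by l square. *)
have [[j jE]|nj] := pselect (exists j, (j < l)%N /\ j%:Z = p.+1%:Z + n%:Z - g p.+1); last first.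
  congr (catalan _ _ _); apply: eq_in_filter => -[a b]; rewrite mem_pairs => /andP[al bl].
  rewrite /P1 /P /= xpair_eqE.
  have [->|/eqP au] := eqVneq a u; first by rewrite g'u; lia.
  have [->|/eqP ap] := eqVneq a p.+1; last by rewrite g'x ?orbF.
  rewrite g'p1 orbF; apply/idP/idP => H; last by lia.
  have : b%:Z <> p.+1%:Z + n%:Z - g p.+1 by move=> E; apply: nj; exists b.
  by lia.
case: jE => jl jE.
rewrite (@catalan_rec _ (roots g') (p.+1, j)); last first.
  apply: filter_pairs_cons => //=; first by rewrite g'p1; lia.
  move=> a b al bl; rewrite /P1 /P /= !xpair_eqE.
  have [->|/eqP au] := eqVneq a u; first by rewrite g'u; lia.
  have [->|/eqP ap] := eqVneq a p.+1; last by rewrite g'x ?orbF.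
  by rewrite g'p1 /=; lia.
rewrite (catalan_swap0 aphi) ?mulr0 ?addr0 //.
by rewrite /raise /root /eps /= -/g'; lia.
Qed.

(* Row z of the root set loses its leftmost root when z is lowered. *)
Lemma kcat_lower z phi g j : (z < l)%N -> (j < l)%N -> z%:Z + n%:Z - g z = j%:Z ->
  catalan (roots g) phi (lower g z) =
  kcat phi (lower g z) + t * catalan (roots g) phi (lower g j).
Proof.
move=> zl jl fz; rewrite (@catalan_rec _ (roots (lower g z)) (z, j)).
  congr (_ + _ * catalan _ _ _); apply/funext => x.
  by rewrite /raise /lower /root /=; ring.
apply: filter_pairs_cons => //=; first by rewrite /lower /eps; lia.
move=> a b al bl; rewrite /lower /eps /= xpair_eqE.
by have [->|_] := eqVneq a z; rewrite /=; lia.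
Qed.

Lemma kcat_lower_last z phi g : (z < l)%N -> l%:Z <= z%:Z + n%:Z - g z ->
  catalan (roots g) phi (lower g z) = kcat phi (lower g z).
Proof.
move=> zl fz; congr (catalan _ _ _); apply: eq_in_filter => -[a b].
rewrite mem_pairs => /andP[al bl]; rewrite /lower /eps /=.
by have [->|_] := eqVneq a z; rewrite /=; lia.
Qed.

End Straightening.
End Raising.

(** * Bounce paths and ladders *)

Local Open Scope nat_scope.

Section Bounce.
Variables (n : nat) (mu : nat -> nat).
Hypothesis mono : forall i j, i <= j -> mu j <= mu i.
Hypothesis mu_lt : forall i, mu i < n.

Definition down (i : nat) : nat := i + n - mu i.

Lemma down_add a k : down a + k <= down (a + k).
Proof. by have := mono (leq_addr k a); have := mu_lt a; rewrite /down; lia. Qed.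

Lemma down_gt i : i < down i.
Proof. by have := mu_lt i; rewrite /down; lia. Qed.

Lemma down_lt a b : (down a < down b) = (a < b).
Proof.
apply/idP/idP => [|ab]; last first.
  by have := down_add a (b - a); rewrite subnKC; lia.
by apply: contraTT; rewrite -!leqNgt => ba; have := down_add b (a - b); rewrite subnKC; lia.
Qed.

Lemma down_inj : injective down.
Proof.
move=> a b E; have := down_lt a b; have := down_lt b a; rewrite E ltnn.
by move=> /esym/negbT; rewrite -leqNgt => ? /esym/negbT; rewrite -leqNgt; lia.
Qed.

Definition flat (e x : nat) := forall i, i <= e -> mu (x + i) = mu x.

(* Climbing a bounce path from x: hs lists x and the rows above it on its
   bounce path, each being the first of e + 1 equal parts, up to a row which is
   not hit by [down] although the e next ones are, by rows u, ..., u + e - 1. *)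
Inductive ladder (e : nat) : nat -> seq nat -> nat -> Prop :=
| ladder_top x u : flat e x -> (forall w, down w <> x) ->
    (forall i, i < e -> down (u + i) = (x + i).+1) -> ladder e x [:: x] u
| ladder_step x hs u : flat e (down x) -> ladder e x hs u ->
    ladder e (down x) (down x :: hs) u.

Lemma ladder_flat e x hs u : ladder e x hs u -> flat e x.
Proof. by case. Qed.

Lemma flat_down e x i : flat e x -> i <= e -> down (x + i) = down x + i.
Proof. by move=> fx ie; have := mu_lt x; rewrite /down fx //; lia. Qed.

(** The bounded partition of the inner core of a ladder cover: e + 1 rows lose a unit and e rows
    gain one, whence the difference 1 in size. The truncated subtraction is harmless when [flat e y]
    holds and [mu y] is positive. *)
Definition block_shift (e y u : nat) : nat -> nat := fun r =>
  (mu r - (y <= r <= y + e)) + (u <= r < u + e).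

Section Climb.
Variables (R : comNzRingType) (t : R) (B l : nat).
Hypothesis tB : (t ^+ B = 0)%R.
Hypothesis no2 : forall x : R, (x + x = 0)%R -> x = 0%R.
Variables (phi : (nat -> int) -> R) (e y z : nat).
Hypothesis phi_anti : forall p, p.+1 < l -> p.+1 != z -> anti p phi.
Hypothesis yel : y + e < l.
Hypothesis flat_y : flat e y.

Local Notation kc := (kcat t B l n phi).

(** State of the climb at level x after i steps: rows x + 1, ..., x + i have each handed one unit
    over to rows u, ..., u + i - 1. For x = y and i = 0 the terms combine to mu - e_y. *)
Definition stage (x i u : nat) : nat -> int := fun r =>
  ((mu r)%:Z - (y <= r <= y + e)%N%:Z + (x + i < r <= x + e)%N%:Z
   + (u <= r < u + i)%N%:Z)%R.

Section Step.
Variables (x i u : nat).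
Hypothesis ie : i < e.
Hypothesis flat_x : flat e x.
Hypothesis xy : (x = y /\ (y + i).+1 <= down y) \/
  [/\ x + e < y, x + e < down x & y + e < down y].
Hypothesis hu : forall j, j < i -> down (u + j) = (x + j).+1.
Hypothesis xz : (x + i).+1 != z.

Lemma u_lt_x : 0 < i -> u + i <= x.
Proof.
move=> i0; have h : i.-1 < i by lia.
suff : u + i.-1 < x by lia.
by rewrite -down_lt (hu h); move: xy => [[-> ]|[]]; lia.
Qed.

(** Row y drops out because it has been lowered; the raised rows u, ..., u + i - 1 now start in
    columns x, ..., x + i - 1, and the other modified rows start further right than x + i + 1. So a
    row starting in that column can be looked for in mu itself. *)
Lemma stage_value r :
  ((r%:Z + n%:Z - stage x i u r)%R = ((x + i).+1)%:Z%R) <-> (down r = (x + i).+1 /\ r <> y).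
Proof.
have ul := u_lt_x; have mr := mu_lt r.
have Er : ((down r)%:Z = r%:Z + n%:Z - (mu r)%:Z)%R by rewrite /down; lia.
rewrite /stage.
have [uri|nuri] := boolP (u <= r < u + i).
  have := hu (_ : r - u < i); rewrite subnKC; last by lia.
  by move=> /(_ ltac:(lia)) dr; split; lia.
have [yr|nyr] := boolP (y <= r <= y + e).
  have := down_add y (r - y); rewrite subnKC; last by lia.
  by move=> dr; split; move: xy => [[xy' ?]|[? ? ?]]; lia.
have [xr|nxr] := boolP (x + i < r <= x + e).
  have := down_add x (r - x); rewrite subnKC; last by lia.
  by have := down_gt r; move=> ? dr; split; move: xy => [[xy' ?]|[? ? ?]]; lia.
by split=> [|[]]; lia.
Qed.

Lemma stage_up : (stage x i u (x + i).+1 = stage x i u (x + i) + 1)%R.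
Proof.
have ul := u_lt_x; have := flat_x (ltnW ie); have := flat_x ie.
rewrite /stage addnS => -> ->.
have -> : (u <= (x + i).+1 < u + i) = false by lia.
have -> : (u <= x + i < u + i) = false by lia.
by move: xy => [[xy' ?]|[? ? ?]]; lia.
Qed.

Lemma stage0 : (forall w, down w = (x + i).+1 -> w = y) -> kc (stage x i u) = 0%R.
Proof.
move=> nw; apply: (kcat0 t B no2 (p := x + i)); first apply: phi_anti => //.
- by move: xy => [[xy' ?]|[? ? ?]]; lia.
- by move: xy => [[xy' ?]|[? ? ?]]; lia.
- exact: stage_up.
- by move=> r _ /stage_value [/nw].
Qed.

Lemma stage_step : down (u + i) = (x + i).+1 -> u + i <> y ->
  kc (stage x i u) = (t * kc (stage x i.+1 u))%R.
Proof.
move=> du uy; have uv := proj2 (stage_value (u + i)) (conj du uy).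
have pl : (x + i).+1 < l by move: xy => [[xy' ?]|[? ? ?]]; lia.
have ux : u + i < (x + i).+1 by rewrite -du down_gt.
rewrite (kcat_straighten tB no2 (p := x + i) (u := u + i)) //.
- congr (_ * kcat _ _ _ _ _ _)%R; apply/funext => r.
  rewrite /raise /root /eps /stage /=; lia.
- exact: phi_anti.
- exact: stage_up.
- have ul := u_lt_x; rewrite /stage; have := flat_x (ltnW ie).
  have -> : (u <= x + i < u + i) = false by lia.
  have := mu_lt x; move: xy; rewrite /down => -[[xy' ?]|[? ? ?]] ? ->; last lia.
  have yn : down y <> (y + i).+1.
    by move=> E; apply: uy; apply: down_inj; rewrite du E xy'.
  by move: yn; rewrite /down; lia.
- by lia.
- by move=> r _ /stage_value [dr ry]; apply: down_inj; rewrite dr du.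
Qed.

End Step.

Lemma stage_0 x u v : stage x 0 u = stage x 0 v.
Proof. by apply/funext => r; rewrite /stage; lia. Qed.

(** One level of the climb. Each step needs a row sent by [down] to x + i + 1. As [down] is strictly
    increasing, rows with consecutive images are consecutive, so the first of them fixes u; a
    missing one makes the value vanish. *)
Lemma level_upto x m : m <= e -> flat e x ->
  (x = y /\ y + m < down y) \/ [/\ x + e < y, x + e < down x & y + e < down y] ->
  (forall i, i < m -> (x + i).+1 != z) ->
  (exists2 u, (forall i, i < m -> down (u + i) = (x + i).+1) &
      kc (stage x 0 0) = (t ^+ m * kc (stage x m u))%R) \/
  (kc (stage x 0 0) = 0%R /\ exists2 i, i < m & forall w, down w <> (x + i).+1).
Proof.
move=> me fx xy zx; elim: m me xy zx => [|m IH] me xy zx.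
  by left; exists 0 => //; rewrite expr0 mul1r.
have xy' : (x = y /\ (y + m).+1 <= down y) \/ [/\ x + e < y, x + e < down x & y + e < down y].
  by move: xy => [[? ?]|[? ? ?]]; [left; lia|right].
case: IH => [||i im|[u hu E]|[E [i im hi]]]; first exact: ltnW.
- by move: xy => [[? ?]|[? ? ?]]; [left; lia|right].
- by apply: zx; apply: ltnW.
- have [[w dw]|nw] := pselect (exists w, down w = (x + m).+1); last first.
    right; split; last by exists m => // w dw; apply: nw; exists w.
    by rewrite E (stage0 me fx xy' hu) ?mulr0 ?zx // => w dw; case: nw; exists w.
  have [v [hv Ev dv]] : exists v, [/\ forall i, i < m -> down (v + i) = (x + i).+1,
      stage x m u = stage x m v & down (v + m) = (x + m).+1].
    case: (m) hu dw => [|k] hu dw.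
      by exists w; split; [by []|exact: stage_0|rewrite addn0].
    exists u; split=> //; have dk := hu _ (ltnSn k); rewrite -dw; congr down.
    have : u + k < w by rewrite -down_lt dk dw; lia.
    have : w < (u + k).+2 by rewrite -down_lt dw; have := down_add (u + k) 2; rewrite dk !addn2; lia.
    by lia.
  left; exists v => [i|]; first by rewrite ltnS leq_eqVlt => /orP[/eqP->|/hv].
  rewrite E Ev exprSr -mulrA (stage_step me fx xy' hv) ?zx // => vy.
  by move: dv; rewrite vy; move: xy => [[? ?]|[? ? ?]]; lia.
- by right; split=> //; exists i => //; apply: ltnW.
Qed.

(** When the bounce from y lands inside its own block, the straightening reaches column [down y],
    whose only preimage is y itself. That row has been lowered, so the root set is symmetric
    there. *)
Lemma kcat_wide_block : z <= y -> down y <= y + e -> kc (stage y 0 0) = 0%R.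
Proof.
move=> zy dy; have yd := down_gt y; set m := (down y - y).-1.
have me : m < e by rewrite /m; lia.
have ym : (y + m).+1 = down y by rewrite /m; lia.
case: (@level_upto y m); [exact: ltnW|by []|by left; lia| | |by case].
  by move=> i _; lia.
move=> [u hu ->]; rewrite (stage0 me flat_y _ hu) ?mulr0 //.
- by left; split=> //; rewrite ym.
- by lia.
- by move=> w; rewrite ym => /down_inj.
Qed.

Definition final (u : nat) : nat -> int := fun r =>
  ((mu r)%:Z - (y <= r <= y + e)%N%:Z + (u <= r < u + e)%N%:Z)%R.

(** Strong induction up the bounce path. The alternative about z is the form that survives the
    induction: once the climb has passed z, only [down x <= z] is known, and it still keeps z out of
    x + 1, ..., x + e. *)
Lemma climb x : y + e < down y -> flat e x -> x = y \/ x + e < y /\ x + e < down x ->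
  (exists k, iter k down z = x) \/ down x <= z ->
  (exists hs u, ladder e x hs u /\
     kc (stage x 0 0) = (t ^+ (size hs * e) * kc (final u))%R) \/
  (kc (stage x 0 0) = 0%R /\ forall hs u, ~ ladder e x hs u).
Proof.
move=> yd; elim/ltn_ind: x => x IH fx xy zx.
have xy' : (x = y /\ y + e < down y) \/ [/\ x + e < y, x + e < down x & y + e < down y].
  by move: xy => [?|[? ?]]; [left|right].
have xd : x + e < down x by case: xy => [->|[]].
have zxi i : i < e -> (x + i).+1 != z.
  move=> ie; case: zx => [[k xk]|]; last by lia.
  suff : z <= x by lia.
  by rewrite -xk; elim: (k) => //= j; have := down_gt (iter j down z); lia.
case: (level_upto (leqnn e) fx xy' zxi) => [[u hu E]|[E [i ie hi]]]; last first.
  right; split=> // hs u lad; case: lad fx hi => [x' u' _ _ /(_ i ie)|x' hs' u' _ /ladder_flat fx' _ hi].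
    by move=> du _ /(_ _ du).
  by apply: (hi (x' + i.+1)); rewrite (flat_down fx') // addnS.
have [[w dw]|nw] := pselect (exists w, down w = x); last first.
  left; exists [:: x], u; split.
    by apply: ladder_top => // w dw; apply: nw; exists w.
  rewrite E mul1n; congr (_ * kc _)%R; apply/funext => r.
  by rewrite /stage /final; lia.
have hw i : i <= e -> down (w + i) = x + i.
  case: i => [|i] ie; first by rewrite !addn0.
  suff -> : w + i.+1 = u + i by rewrite hu // addnS.
  suff <- : w.+1 = u by lia.
  have h0 := hu _ (leq_ltn_trans (leq0n i) ie); rewrite !addn0 in h0.
  have : w < u by rewrite -down_lt h0 dw; lia.
  have : u < w.+2 by rewrite -down_lt h0; have := down_add w 2; rewrite dw !addn2; lia.
  by lia.
have fw : flat e w.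
  by move=> i ie; have := hw _ ie; have := mu_lt (w + i); have := mu_lt w; move: dw; rewrite /down; lia.
have we : w + e < down w.
  by rewrite dw; apply: contraTT xd; rewrite -!leqNgt => xw;
     have := down_add x (w + e - x); rewrite subnKC // hw //; lia.
(* The e units now sit in rows w + 1, ..., w + e: the end of this level is the beginning of the next
   one. *)
have E2 : stage x e u = stage w 0 0.
  apply/funext => r; rewrite /stage.
  have [->|e0] := posnP e; first by lia.
  suff -> : u = w.+1 by lia.
  apply: down_inj; rewrite -(addn0 u) hu // -(addn1 w) hw //; lia.
case: (IH w) => [| | | |[hs [v [lad E3]]]|[E3 nl]].
- by rewrite -dw down_gt.
- by [].
- right; split=> //; rewrite -down_lt hw //; case: xy => [->|[]]; lia.
- case: zx => [[[|k] /= xk]|]; last by rewrite dw; have := down_gt x; lia.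
    by right; rewrite xk dw.
  by left; exists k; apply: down_inj; rewrite dw.
- left; exists (x :: hs), v; split; first by rewrite -dw; apply: ladder_step; rewrite ?dw.
  by rewrite E E2 E3 mulrA -exprD mulSn.
- right; split; first by rewrite E E2 E3 mulr0.
  move=> hs v lad; case: lad dw => [x' u' _ nx' _ /nx' //|x' hs' u' _ lad' /down_inj wx'].
  by apply: (nl hs' u'); rewrite wx'.
Qed.

End Climb.

Lemma ladder_det e x hs u hs' u' : ladder e x hs u -> ladder e x hs' u' ->
  hs = hs' /\ (0 < e -> u = u').
Proof.
move=> lad; elim: lad hs' u' => {x hs u} [x u fx nx hu|x hs u fx lad IH] hs' u' lad'.
  case: lad' fx nx hu => [x' v _ _ hv _ _ hu|x' hs2 v _ _ _ /(_ x')//].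
  split=> // e0; apply: down_inj.
  by have := hu _ e0; have := hv _ e0; rewrite !addn0 => -> ->.
remember (down x) as x1 eqn:Ex1; case: lad' Ex1 => [x' v _ nx' _ E|x' hs2 v _ lad2 /down_inj E].
  by case: (nx' x).
by subst; have [-> ?] := IH _ _ lad2.
Qed.

Lemma ladder_mem e x hs u : ladder e x hs u -> x \in hs.
Proof. by case=> *; rewrite inE eqxx. Qed.

Lemma ladder_gap e x hs u : ladder e (down x) hs u -> flat e x ->
  down x + e < down (down x) -> x + e < down x.
Proof.
move=> _ fx; apply: contraTT; rewrite -!leqNgt => xe.
by have := down_add (down x) (x + e - down x); rewrite subnKC // (flat_down fx) //; lia.
Qed.

Lemma ladder_props e x hs u : ladder e x hs u -> x + e < down x ->
  [/\ pairwise (fun h h' => h' + e < h) hs,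
      (forall h : nat, h \in hs -> h <= x /\ h + e < down h),
      (forall h : nat, h \in hs -> flat e h /\ (h = x \/ down h \in hs)) &
      (forall h : nat, h \in hs -> 0 < e -> u + e <= h)].
Proof.
elim=> {x hs u} [x u fx nx hu|x hs u fx lad IH] xe.
  split=> // h; rewrite inE => /eqP -> //; first by split=> //; left.
  move=> e0; have : down (u + e.-1) < down x by rewrite hu; lia.
  by rewrite down_lt; lia.
have xe' : x + e < down x.
  by apply: ladder_gap (ladder_step fx lad) _ xe; exact: ladder_flat lad.
have [gap le fl ue] := IH xe'; split.
- rewrite /= gap andbT; apply/allP => h /le[]; lia.
- by move=> h; rewrite inE => /orP[/eqP->//|/le[]]; have := down_gt x; lia.
- move=> h; rewrite inE => /orP[/eqP->|ih]; first by split=> //; left.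
  have [fh hx] := fl _ ih; split=> //; right; rewrite inE.
  by case: hx => [->|->]; rewrite ?eqxx ?orbT.
- move=> h; rewrite inE => /orP[/eqP->|ih e0]; last exact: ue.
  by move=> e0; have := ue x (ladder_mem lad) e0; have := down_gt x; lia.
Qed.

Lemma ladder_pre e x hs u h i r : ladder e x hs u -> h \in hs -> i <= e ->
  down r = h + i -> (exists2 h', h' \in hs & r = h' + i) \/ (0 < i /\ r = u + i.-1).
Proof.
elim=> {x hs u} [x u fx nx hu|x hs u fx lad IH]; rewrite inE.
  move=> /eqP ->; case: i => [|i] ie dr; first by case: (nx r); rewrite dr addn0.
  by right; split=> //; apply: down_inj; rewrite dr hu // addnS.
move=> /orP[/eqP->|ih] ie dr.
  left; exists x; first by rewrite inE (ladder_mem lad) orbT.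
  by apply: down_inj; rewrite dr (flat_down (ladder_flat lad)).
have [[h' ih' ->]|?] := IH ih ie dr; last by right.
by left; exists h'; rewrite // inE ih' orbT.
Qed.

Lemma ladder_summit e x hs u : ladder e x hs u ->
  exists2 a : nat, a \in hs &
    (forall w, down w <> a) /\ forall i, i < e -> down (u + i) = (a + i).+1.
Proof.
elim=> {x hs u} [x u fx nx hu|x hs u fx lad [a ia ha]]; first by exists x; rewrite ?inE ?eqxx.
by exists a; rewrite // inE ia orbT.
Qed.

(** The blocks below z correspond to the bounces leading from z to x. This is how the exponent
    counting bounces becomes the term N of the spin. *)
Lemma ladder_path e x hs u (z : nat) : ladder e x hs u -> x + e < down x -> z \in hs ->
  iter (count (ltn z) hs) down z = x.
Proof.
elim=> {x hs u} [x u fx nx hu|x hs u fx lad IH] xe; rewrite inE.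
  by move=> /eqP ->; rewrite /= ltnn.
have xe' : x + e < down x.
  by apply: ladder_gap (ladder_step fx lad) _ xe; exact: ladder_flat lad.
have [_ le _ _] := ladder_props lad xe'; have := down_gt x => xd.
case/orP => [/eqP->|iz] /=.
  rewrite ltnn add0n (_ : count _ _ = 0) //; apply/eqP; rewrite -leqn0 leqNgt -has_count.
  by apply/hasPn => h /le[? _] /=; lia.
have [zx _] := le _ iz; rewrite (_ : (z < down x) = true) ?add1n /=; last by lia.
by rewrite IH.
Qed.

(** The climb stops only at a row without preimage, so it has met every row whose bounce path leads
    to x. *)
Lemma path_ladder e x hs u z k : ladder e x hs u -> iter k down z = x -> z \in hs.
Proof.
move=> lad; elim: lad k => {x hs u} [x u fx nx hu|x hs u fx lad IH] [|k] /= E.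
- by rewrite E inE.
- by case: (nx _ E).
- by rewrite E inE eqxx.
- by rewrite inE (IH k) ?orbT //; exact: down_inj.
Qed.

End Bounce.

(** * Cores and bounded partitions *)

Local Open Scope nat_scope.

Lemma nth_part s i j : is_part s -> i <= j -> nth 0 s j <= nth 0 s i.
Proof.
move=> /andP[ss _] ij; have [js|sj] := ltnP j (size s); last by rewrite (nth_default _ sj).
have trg : transitive geq by move=> a b c /= ba cb; exact: leq_trans cb ba.
by apply: (sorted_leq_nth trg leqnn 0 ss) => //; rewrite inE; lia.
Qed.

Lemma mem_boxes s r c :
  ((r, c) \in [seq (a, b) | a <- iota 0 (size s), b <- iota 0 (nth 0 s a)]) =
  (c < nth 0 s r).
Proof.
apply/allpairsPdep/idP => [[a [b []]]|cr].
  by rewrite !mem_iota /= => _ bl [-> ->].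
exists r, c; rewrite !mem_iota; split=> //=.
by case: ltnP => // sr; rewrite nth_default in cr.
Qed.

Lemma mem_diagram s r c : ((r, c) \in diagram s) = (c < nth 0 s r).
Proof. by rewrite inE /= mem_boxes. Qed.

Lemma card_fset_seq (T : choiceType) (A : {fset T}) (l : seq T) :
  uniq l -> A =i l -> #|` A| = size l.
Proof.
move=> ul Al; have -> : A = [fset x in l]%fset by apply/fsetP => x; rewrite Al inE.
by rewrite card_fseq undup_id.
Qed.

Lemma col_height s c : is_part s -> exists h, forall x, (c < nth 0 s x) = (x < h).
Proof.
move=> ps; exists (find (fun y => y <= c) s) => x.
have [xh|hx] := ltnP x (find (fun y => y <= c) s).
  by have := before_find 0 xh; lia.
have := nth_part ps hx; have [|] := boolP (has (fun y => y <= c) s).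
  by move=> /(nth_find 0); lia.
by move=> /hasNfind E; rewrite E in hx *; rewrite nth_default // ; lia.
Qed.

Lemma hookE s r c h : (forall x, (c < nth 0 s x) = (x < h)) -> c < nth 0 s r ->
  hook s (r, c) = (h - r.+1) + (nth 0 s r - c).
Proof.
move=> hh cr; rewrite /hook /=; congr (_ + _).
  rewrite (@card_fset_seq _ _ [seq (x, c) | x <- iota r.+1 (h - r.+1)]).
  - by rewrite size_map size_iota.
  - by rewrite map_inj_uniq ?iota_uniq // => a b [].
  case=> a b; rewrite !inE /= mem_boxes.
  apply/and3P/mapP => [[ba ra /eqP bc]|[x xh [-> ->]]].
    by exists a; rewrite ?bc //= mem_iota; move: ba; rewrite bc hh; lia.
  by move: xh; rewrite mem_iota hh; split=> //; lia.
rewrite (@card_fset_seq _ _ [seq (r, x) | x <- iota c (nth 0 s r - c)]).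
- by rewrite size_map size_iota.
- by rewrite map_inj_uniq ?iota_uniq // => a b [].
case=> a b; rewrite !inE /= mem_boxes.
apply/and3P/mapP => [[ba /eqP ra bc]|[x xh [-> ->]]].
  by exists b; rewrite ?ra //= mem_iota; move: ba; rewrite ra; lia.
by move: xh; rewrite mem_iota => xh; split=> //; lia.
Qed.

Lemma nth_pcore K s r : nth 0 (pcore K s) r =
  count (fun c => hook s (r, c) <= K) (iota 0 (nth 0 s r)).
Proof.
have [rs|sr] := ltnP r (size s); last first.
  by rewrite !nth_default // size_map size_iota.
rewrite (nth_map 0) ?size_iota // nth_iota // add0n.
rewrite (@card_fset_seq _ _ [seq (r, x) | x <- iota 0 (nth 0 s r) & hook s (r, x) <= K]).
- by rewrite size_map size_filter.
- by rewrite map_inj_uniq ?filter_uniq ?iota_uniq // => a b [].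
case=> a b; rewrite !inE /= mem_boxes.
apply/and3P/mapP => [[ba /eqP ra bc]|[x xh [-> ->]]].
  by exists b; rewrite ?ra //= mem_filter mem_iota -ra bc.
by move: xh; rewrite mem_filter mem_iota => /and3P[? ? ?]; split.
Qed.

Lemma count_upclosed (P : pred nat) N : (forall c d, c <= d -> d < N -> P c -> P d) ->
  forall c, c < N -> P c = (N - count P (iota 0 N) <= c).
Proof.
elim: N => // N IH up c cN.
rewrite -addn1 iotaD count_cat /= add0n addn0.
have cs := count_size P (iota 0 N); rewrite size_iota in cs.
have [PN|nPN] := boolP (P N).
  have [->|cN'] := eqVneq c N; first by rewrite PN; lia.
  rewrite IH; [lia| |lia] => a b ab bN; apply: up => //; exact: ltnW.
have no d : d < N.+1 -> P d = false by move=> dN; apply: contraNF nPN; apply: up; lia.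
suff -> : count P (iota 0 N) = 0 by rewrite no //; lia.
apply/eqP; rewrite -leqn0 leqNgt -has_count; apply/hasPn => d.
by rewrite mem_iota => dN; rewrite no //; lia.
Qed.

Section Core.
Variables (K : nat).

(** Hook lengths decrease along a row, so the m boxes counted are the last ones of row r. The first
    of them has hook at most K, which bounds row r + K + 1 - m from above; the box to its left has
    hook at least K + 2, since K + 1 is excluded, which bounds that row from below. *)
Lemma core_rec s r : is_core K.+1 s ->
  nth 0 (pcore K s) r <= K /\
  nth 0 s r = nth 0 (pcore K s) r + nth 0 s (r + K.+1 - nth 0 (pcore K s) r).
Proof.
move=> [ps core]; set m := nth 0 (pcore K s) r; set f := r + _ - _.
have upm c : c < nth 0 s r -> (hook s (r, c) <= K) = (nth 0 s r - m <= c).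
  rewrite /m nth_pcore => cr.
  apply: (count_upclosed (P := fun c => hook s (r, c) <= K)) cr => a b ab br.
  have [h hh] := col_height a ps; have [h' hh'] := col_height b ps.
  rewrite (hookE hh) ?(hookE hh') //; last by lia.
  have : h' <= h.
    case: h' hh' => // h' /(_ h'); rewrite ltnSn => hb.
    by rewrite -hh; lia.
  by lia.
have ms : m <= nth 0 s r.
  by rewrite /m nth_pcore -[leqRHS](size_iota 0) count_size.
have mK : m <= K.
  have [->//|m0] := posnP m.
  have cs : nth 0 s r - m < nth 0 s r by lia.
  have [h hh] := col_height (nth 0 s r - m) ps.
  by have := upm _ cs; rewrite leqnn (hookE hh) //; lia.
split=> //; apply/eqP; rewrite eqn_leq; apply/andP; split; last first.
  have [m0|m0] := posnP m; first by rewrite m0; apply: nth_part => //; lia.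
  have cs : nth 0 s r - m < nth 0 s r by lia.
  have [h hh] := col_height (nth 0 s r - m) ps.
  have := upm _ cs; rewrite leqnn (hookE hh) // => hk.
  have := hh f; rewrite leqNgt; have := hh r; rewrite cs; lia.
have [c0|c0] := posnP (nth 0 s r - m); first by lia.
have cs : (nth 0 s r - m).-1 < nth 0 s r by lia.
have [h hh] := col_height (nth 0 s r - m).-1 ps.
have := core (r, (nth 0 s r - m).-1); rewrite mem_diagram => /(_ cs).
have := upm _ cs; rewrite (hookE hh) // => hk.
by have := hh f; lia.
Qed.

Lemma rec_core s (m : nat -> nat) : is_part s -> (forall r, m r <= K) ->
  (forall r, nth 0 s r = m r + nth 0 s (r + K.+1 - m r)) ->
  is_core K.+1 s /\ nth 0 (pcore K s) =1 m.
Proof.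
move=> ps mK rec.
have hk r c : c < nth 0 s r ->
    if nth 0 s (r + K.+1 - m r) <= c then hook s (r, c) <= K else K.+1 < hook s (r, c).
  move=> cr; have [h hh] := col_height c ps; rewrite (hookE hh) //.
  have := hh (r + K.+1 - m r); have := hh r; have := rec r; have := mK r.
  by rewrite cr; case: ifP; lia.
split; first split=> //.
  move=> [r c]; rewrite mem_diagram => /hk; case: ifP => _ h; apply/eqP => E; rewrite E in h; lia.
move=> r; rewrite nth_pcore.
rewrite (@eq_in_count _ _ (fun c => nth 0 s (r + K.+1 - m r) <= c)); last first.
  by move=> c; rewrite mem_iota /= => /hk; case: ifP; lia.
have -> : nth 0 s r = nth 0 s (r + K.+1 - m r) + m r by rewrite {1}rec addnC.
rewrite iotaD count_cat add0n (_ : count _ (iota 0 _) = 0) ?add0n; last first.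
  apply/eqP; rewrite -leqn0 leqNgt -has_count; apply/hasPn => d.
  by rewrite mem_iota; lia.
rewrite -[RHS](size_iota (nth 0 s (r + K.+1 - m r))); apply/eqP.
by rewrite -all_count; apply/allP => d; rewrite mem_iota; lia.
Qed.

Lemma rec_uniq (m g g' : nat -> nat) L : (forall r, m r <= K) ->
  (forall r, g r = m r + g (r + K.+1 - m r)) ->
  (forall r, g' r = m r + g' (r + K.+1 - m r)) ->
  (forall r, L <= r -> g r = 0) -> (forall r, L <= r -> g' r = 0) -> g =1 g'.
Proof.
move=> mK recg recg' g0 g'0 r; move: {2}(L - r) (leqnn (L - r)) => d.
elim: d r => [|d IH] r rd; first by rewrite g0 ?g'0; lia.
by rewrite recg recg' IH //; have := mK r; lia.
Qed.

Lemma part_ext s s' : is_part s -> is_part s' -> nth 0 s =1 nth 0 s' -> s = s'.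
Proof.
move=> /andP[_ n0] /andP[_ n0'] E; apply: (@eq_from_nth _ 0) => [|i _]; last exact: E.
case: (ltngtP (size s) (size s')) => // h.
  by have := mem_nth 0 h; rewrite -E nth_default // (negbTE n0').
by have := mem_nth 0 h; rewrite E nth_default // (negbTE n0).
Qed.

Lemma core_inj s s' : is_core K.+1 s -> is_core K.+1 s' ->
  nth 0 (pcore K s) =1 nth 0 (pcore K s') -> s = s'.
Proof.
move=> cs cs' E; apply: part_ext; [by case: cs|by case: cs'|].
apply: (@rec_uniq (nth 0 (pcore K s)) _ _ (size s + size s')).
- by move=> r; case: (core_rec r cs).
- by move=> r; case: (core_rec r cs).
- by move=> r; rewrite E; case: (core_rec r cs').
- by move=> r rs; rewrite nth_default //; lia.
- by move=> r rs; rewrite nth_default //; lia.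
Qed.

(** If m increased from j to j + 1, the recurrence would give row j + 1 a larger first term and a
    second term taken from a row not further down, hence make it longer than row j. *)
Lemma core_mono s i j : is_core K.+1 s -> i <= j ->
  nth 0 (pcore K s) j <= nth 0 (pcore K s) i.
Proof.
move=> cs; move: j; elim=> [|j IH]; first by rewrite leqn0 => /eqP ->.
rewrite leq_eqVlt => /orP[/eqP->//|ij]; apply: leq_trans (IH _) => //.
have [ps _] := cs; rewrite leqNgt; apply/negP => lt.
have [k1 e1] := core_rec j cs; have [k2 e2] := core_rec j.+1 cs.
have := nth_part ps (leqnSn j).
have := @nth_part _ (j.+1 + K.+1 - nth 0 (pcore K s) j.+1)
  (j + K.+1 - nth 0 (pcore K s) j) ps.
by lia.
Qed.

Lemma core_size s L : is_core K.+1 s -> (forall r, L <= r -> nth 0 (pcore K s) r = 0) ->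
  size s <= L.
Proof.
move=> cs z; have [//|Ls] := leqP (size s) L; exfalso.
have [/andP[_ n0] _] := cs.
suff zero r : L <= r -> nth 0 s r = 0 by have := mem_nth 0 Ls; rewrite zero // (negbTE n0).
move: {2}(size s - r) (leqnn (size s - r)) => d.
elim: d r => [|d IH] r rd Lr; first by rewrite nth_default //; lia.
have [_ ->] := core_rec r cs; rewrite z // subn0 IH //; lia.
Qed.

Lemma part_of_fun (g : nat -> nat) L : (forall i j, i <= j -> g j <= g i) ->
  (forall r, L <= r -> g r = 0) -> exists2 s, is_part s & nth 0 s =1 g.
Proof.
move=> mono g0; exists (mkseq g (find (fun r => g r == 0) (iota 0 L))).
  rewrite /is_part; apply/andP; split.
    rewrite sorted_map; apply: (sub_sorted _ (iota_ltn_sorted _ _)) => a b /ltnW; exact: mono.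
  apply/mapP => -[r]; rewrite mem_iota /= add0n => /[dup] rf /(before_find 0).
  rewrite nth_iota; last by have := find_size (fun r => g r == 0) (iota 0 L); rewrite size_iota; lia.
  by move=> /negbT; rewrite add0n => h /esym/eqP; rewrite (negbTE h).
move=> r; set d := find _ _; have [rd|dr] := ltnP r d; first by rewrite nth_mkseq.
rewrite nth_default ?size_mkseq //; apply/esym/eqP.
have : g d = 0.
  have [h|h] := boolP (has (fun r => g r == 0) (iota 0 L)).
    have := nth_find 0 h; rewrite nth_iota ?add0n; first by move/eqP.
    by rewrite -{2}(size_iota 0 L) -has_find.
  by apply: g0; rewrite /d (hasNfind h) size_iota.
by have := mono _ _ dr; lia.
Qed.

Lemma core_exists (m : nat -> nat) L : (forall i j, i <= j -> m j <= m i) ->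
  (forall r, m r <= K) -> (forall r, L <= r -> m r = 0) ->
  exists2 s, is_core K.+1 s & nth 0 (pcore K s) =1 m.
Proof.
move=> mono mK m0.
(* Recursion with fuel d. Each jump goes to a strictly larger row, so fuel L is enough to reach the
   rows where m vanishes. *)
pose fix g (d r : nat) {struct d} := if d is d'.+1 then m r + g d' (r + K.+1 - m r) else 0.
have g0 d r : L <= r -> g d r = 0.
  elim: d r => //= d IH r Lr; rewrite m0 // IH //; lia.
have gst d d' r : L - r <= d -> L - r <= d' -> g d r = g d' r.
  elim: d d' r => [|d IH] [|d'] r h h' //=; try by rewrite m0 ?g0 //; lia.
  by congr (_ + _); apply: IH; have := mK r; lia.
have rec r : g L r = m r + g L (r + K.+1 - m r).
  by rewrite (gst _ L.+1) //=; lia.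
have gmono i : g L i.+1 <= g L i.
  move: {2}(L - i) (leqnn (L - i)) => d; elim/ltn_ind: d i => d IH i id.
  have step a k : i < a -> g L (a + k) <= g L a.
    move=> ia; elim: k => [|k IHk]; first by rewrite addn0.
    rewrite addnS; apply: leq_trans IHk.
    have [La|aL] := leqP L (a + k); first by rewrite !g0; lia.
    by apply: (IH (L - (a + k))); lia.
  have mi := mono _ _ (leqnSn i); have ki := mK i; have ki1 := mK i.+1.
  have fi : i < i + K.+1 - m i by lia.
  have := step _ (i.+1 + K.+1 - m i.+1 - (i + K.+1 - m i)) fi.
  by rewrite subnKC => [le|]; [rewrite rec [leqRHS]rec; lia|lia].
have gm i j : i <= j -> g L j <= g L i.
  move=> ij; rewrite -(subnKC ij); elim: (j - i) => [|k IH]; first by rewrite addn0.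
  by rewrite addnS (leq_trans (gmono _)).
have [s ps E] := part_of_fun gm (g0 L).
by exists s; have [] := @rec_core s m ps mK; do ?by move=> r; rewrite !E.
Qed.

Lemma sumn_nth (s : seq nat) L : size s <= L -> sumn s = \sum_(r < L) nth 0 s r.
Proof.
move=> sL; rewrite sumnE (big_nth 0) big_mkord.
rewrite -(big_mkord xpredT (fun r => nth 0 s r)) -(big_mkord xpredT (fun r => nth 0 s r)).
rewrite [RHS](big_cat_nat (n := size s)) //=.
have -> : \sum_(size s <= i < L) nth 0 s i = 0; last by rewrite addn0.
by rewrite big_nat_cond big1 // => r /andP[/andP[sr _] _]; rewrite nth_default.
Qed.

End Core.

(** * Components of a union of ribbons *)

Local Open Scope nat_scope.

Section Ribbons.
Variables (tau kappa hs : seq nat) (e : nat).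
Hypothesis gap : pairwise (fun h h' => h' + e < h) hs.
Hypothesis support : forall r c : nat, nth 0 tau r <= c < nth 0 kappa r ->
  exists2 h : nat, h \in hs & h <= r <= h + e.
Hypothesis nonempty : forall h r : nat, h \in hs -> h <= r <= h + e ->
  nth 0 tau r < nth 0 kappa r.
Hypothesis linked : forall h i : nat, h \in hs -> i < e ->
  nth 0 tau (h + i).+1 <= nth 0 tau (h + i) < nth 0 kappa (h + i).+1.
Hypothesis separated : forall h : nat, h \in hs -> nth 0 kappa (h + e).+1 <= nth 0 tau (h + e).

Local Notation cell := (Defs.skew tau kappa).
Local Notation adj := (@adjacent tau kappa).

Lemma mem_skew (r c : nat) : ((r, c) \in Defs.skew tau kappa) = (nth 0 tau r <= c < nth 0 kappa r).
Proof. by rewrite in_fsetD !mem_diagram -leqNgt. Qed.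

Lemma cellP (b : cell) : nth 0 tau (val b).1 <= (val b).2 < nth 0 kappa (val b).1.
Proof. by rewrite -mem_skew -surjective_pairing; exact: valP. Qed.

Lemma cell_ex (r c : nat) : nth 0 tau r <= c < nth 0 kappa r ->
  exists2 b : cell, (val b).1 = r & (val b).2 = c.
Proof. by rewrite -mem_skew => h; exists [` h]%fset. Qed.

Lemma adjE (b d : cell) : adj b d =
  ((val b).1 == (val d).1) && (((val b).2 == (val d).2.+1) || ((val d).2 == (val b).2.+1)) ||
  ((val b).2 == (val d).2) && (((val b).1 == (val d).1.+1) || ((val d).1 == (val b).1.+1)).
Proof. by rewrite /adjacent; case: (val b) => r c; case: (val d). Qed.

Lemma gap_uniq (h h' r : nat) : h \in hs -> h' \in hs -> h <= r <= h + e -> h' <= r <= h' + e -> h = h'.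
Proof.
move=> hh hh' rh rh'.
elim: hs gap hh hh' => //= a s IH /andP[/allP as_ gs].
rewrite !inE => /orP[/eqP E1|i1] /orP[/eqP E2|i2].
- by rewrite E1 E2.
- by have := as_ _ i2; lia.
- by have := as_ _ i1; lia.
- exact: IH.
Qed.

Definition head_row (b : cell) : nat := head 0 [seq h <- hs | h <= (val b).1 <= h + e].

Lemma head_rowP (b : cell) : head_row b \in hs /\ head_row b <= (val b).1 <= head_row b + e.
Proof.
have [h hh hr] := support (cellP b).
rewrite /head_row; set s := [seq _ <- _ | _].
have : h \in s by rewrite mem_filter hr.
suff : all (fun h => (h \in hs) && (h <= (val b).1 <= h + e)) s.
  by case: s => //= a s /andP[/andP[]].
by apply/allP => a; rewrite mem_filter andbC.
Qed.

Lemma head_row_uniq (b : cell) (h : nat) : h \in hs -> h <= (val b).1 <= h + e -> head_row b = h.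
Proof. by have [ib rb] := head_rowP b => hh hr; apply: gap_uniq rb hr. Qed.

Lemma adj_sym : symmetric adj.
Proof. by move=> b d; rewrite !adjE; lia. Qed.

Lemma adj_head (b d : cell) : adj b d -> head_row b = head_row d.
Proof.
have [ib rb] := head_rowP b; have [id rd] := head_rowP d.
have := cellP b; have := cellP d; rewrite adjE.
move: (val b).1 (val b).2 (val d).1 (val d).2 rb rd => r c r' c' rb rd cd cb.
have key (h h' x : nat) : h \in hs -> h' \in hs -> h <= x <= h + e ->
    h' <= x.+1 <= h' + e -> nth 0 tau x < nth 0 kappa x.+1 -> h = h'.
  move=> ih ih' hx hx' lt; have [xe|xe] := eqVneq x (h + e).
    by have := separated ih; rewrite -xe; lia.
  by apply: (@gap_uniq _ _ x.+1) => //; move: xe; lia.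
case/orP => /andP[/eqP E]; first by subst => _; apply: gap_uniq rb rd.
subst; case/orP => /eqP E; subst.
  by apply/esym; apply: (@key _ _ r') => //; lia.
by apply: (@key _ _ r) => //; lia.
Qed.

Lemma connect_head (b d : cell) : connect adj b d -> head_row b = head_row d.
Proof.
case/connectP => p; elim: p b => [|a p IH] b /=; first by move=> _ ->.
by move=> /andP[/adj_head -> /IH].
Qed.

Lemma connect_row (b d : cell) : (val b).1 = (val d).1 -> (val d).2 = nth 0 tau (val d).1 ->
  connect adj b d.
Proof.
move=> E1 E2; move: {2}((val b).2 - (val d).2) (leqnn ((val b).2 - (val d).2)) => k.
elim: k b E1 => [|k IH] b E1 bk.
  have := cellP b => cb; suff -> : b = d by exact: connect0.
  apply: val_inj; rewrite [LHS]surjective_pairing [RHS]surjective_pairing E1.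
  by congr (_, _); move: cb; rewrite E1 -E2; lia.
have cb := cellP b; have [eb|nb] := eqVneq (val b).2 (nth 0 tau (val b).1).
  by apply: IH => //; move: eb; rewrite E1 -E2; lia.
have [a a1 a2] : exists2 a : cell, (val a).1 = (val b).1 & (val a).2 = (val b).2.-1.
  by apply: cell_ex; move: nb; lia.
apply: (@connect_trans _ _ a); last by apply: IH; rewrite ?a1 ?a2 //; lia.
by apply: connect1; rewrite adjE a1 a2; move: nb; lia.
Qed.

Lemma connect_base (b d : cell) : (val d).1 = head_row b ->
  (val d).2 = nth 0 tau (val d).1 -> connect adj b d.
Proof.
move=> E1 E2; have [ih rh] := head_rowP b; move: E1 ih rh; move: (head_row b) => h E1 ih rh.
move: {2}((val b).1 - h) (leqnn ((val b).1 - h)) => k.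
elim: k b rh => [|k IH] b rh bk; first by apply: connect_row => //; lia.
have [eb|nb] := eqVneq (val b).1 h; first by apply: IH => //; lia.
set i := (val b).1.-1 - h; have ie : i < e by move: nb; rewrite /i; lia.
have := linked ih ie; rewrite /i.
have -> : (h + ((val b).1.-1 - h)).+1 = (val b).1 by move: nb; lia.
have -> : h + ((val b).1.-1 - h) = (val b).1.-1 by move: nb; lia.
move=> /andP[l1 l2]; have cb := cellP b.
have ne : nth 0 tau (val b).1.-1 < nth 0 kappa (val b).1.-1.
  by apply: (nonempty ih); move: nb; lia.
(* The route to the row above: left to the start [a] of the row, right to the cell [c] in a column
   that both rows share by [linked], then up to [f]. *)
have [a a1 a2] : exists2 a : cell, (val a).1 = (val b).1 & (val a).2 = nth 0 tau (val b).1.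
  by apply: cell_ex; lia.
have [c c1 c2] : exists2 a : cell, (val a).1 = (val b).1 & (val a).2 = nth 0 tau (val b).1.-1.
  by apply: cell_ex; lia.
have [f f1 f2] : exists2 a : cell, (val a).1 = (val b).1.-1 & (val a).2 = nth 0 tau (val b).1.-1.
  by apply: cell_ex; lia.
apply: (connect_trans (connect_row (d := a) _ _)); rewrite ?a1 //.
rewrite (sym_connect_sym adj_sym).
apply: (@connect_trans _ _ c); last by apply: connect_row; rewrite ?a1 ?c1 ?a2.
rewrite (sym_connect_sym adj_sym).
apply: (@connect_trans _ _ f); last by apply: IH; rewrite f1; move: nb; lia.
by apply: connect1; rewrite adjE c1 c2 f1 f2; move: nb; lia.
Qed.

(** Every cell is joined to the leftmost cell of the top row of its block. Conversely no step leaves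
    a block, since by [separated] its last row has no column in common with the row below. *)
Lemma connectE (b d : cell) : connect adj b d = (head_row b == head_row d).
Proof.
apply/idP/eqP => [/connect_head //|E].
have [ih rh] := head_rowP b; have hh : head_row b <= head_row b <= head_row b + e by lia.
have [a a1 a2] : exists2 a : cell, (val a).1 = head_row b & (val a).2 = nth 0 tau (head_row b).
  by apply: cell_ex; have := nonempty ih hh; lia.
apply: (connect_trans (connect_base (d := a) _ _)); rewrite ?a1 //.
by rewrite (sym_connect_sym adj_sym); apply: connect_base; rewrite ?a1.
Qed.

Definition ribbon (h : nat) : {set cell} := [set b : cell | head_row b == h]%SET.

Lemma ribbon_row (h r : nat) : h \in hs -> (r \in Defs.rows (ribbon h)) = (h <= r <= h + e).
Proof.
move=> ih; rewrite mem_undup; apply/mapP/idP => [[b]|hr].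
  by rewrite mem_enum inE => /eqP <- ->; have [] := head_rowP b.
have [b b1 _] : exists2 b : cell, (val b).1 = r & (val b).2 = nth 0 tau r.
  by apply: cell_ex; have := nonempty ih hr; lia.
exists b; last by rewrite b1.
by rewrite mem_enum inE; apply/eqP; apply: head_row_uniq; rewrite ?b1.
Qed.

Lemma mem_components C : (C \in components tau kappa) = (C \in map ribbon hs).
Proof.
have crib (b : cell) : [set y in [set: cell]%SET | connect adj b y]%SET = ribbon (head_row b).
  by apply/setP => d; rewrite !inE connectE eq_sym.
apply/imsetP/mapP => [[b _ ->]|[h ih ->]].
  by exists (head_row b); [case: (head_rowP b)|exact: crib].
have hh : h <= h <= h + e by lia.
have := ribbon_row h ih; rewrite hh mem_undup => /mapP[b].
by rewrite mem_enum inE => /eqP bh _; exists b; rewrite // crib bh.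
Qed.

Lemma ribbon_inj : {in hs &, injective ribbon}.
Proof.
move=> h h' ih ih' E; have hh : h <= h <= h + e by lia.
have := ribbon_row h ih; rewrite hh E ribbon_row // => hh'.
exact: (@gap_uniq _ _ h).
Qed.

Lemma uniq_heads : uniq hs.
Proof. by elim: hs gap => //= a s IH /andP[/allP as_ /IH ->]; rewrite andbT; apply/negP => /as_; lia. Qed.

Lemma size_rows (h : nat) : h \in hs -> size (Defs.rows (ribbon h)) = e.+1.
Proof.
move=> ih; rewrite -(size_iota h e.+1); apply/perm_size/uniq_perm.
- exact: undup_uniq.
- exact: iota_uniq.
by move=> r; rewrite ribbon_row // mem_iota; lia.
Qed.

Lemma all_rows (h z : nat) : h \in hs ->
  all (fun r => z < r) (Defs.rows (ribbon h)) = (z < h).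
Proof.
move=> ih; apply/allP/idP => [|zh r]; first by apply; rewrite ribbon_row //; lia.
by rewrite ribbon_row //; lia.
Qed.

Lemma card_components (P : pred {set cell}) :
  #|[set C in components tau kappa | P C]%SET| = count (fun h => P (ribbon h)) hs.
Proof.
rewrite -size_filter -(size_map ribbon) cardsE.
rewrite -(card_uniqP (_ : uniq (map ribbon [seq h <- hs | P (ribbon h)]))).
  apply: eq_card => C; rewrite unfold_in mem_components.
  apply/andP/mapP => [[/mapP[h ih ->] Ph]|[h]]; first by exists h; rewrite // mem_filter Ph.
  by rewrite mem_filter => /andP[Ph ih] ->; split; rewrite // map_f.
rewrite map_inj_in_uniq ?filter_uniq ?uniq_heads // => a b.
by rewrite !mem_filter => /andP[_ ia] /andP[_ ib]; apply: ribbon_inj.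
Qed.

Lemma cover_spin_ribbons (z : nat) : cover_spin tau kappa z = size hs * e + count (ltn z) hs.
Proof.
rewrite /cover_spin card_components; congr (_ + _); last first.
  by apply: eq_in_count => h ih; rewrite all_rows.
have -> : #|components tau kappa| = size hs.
  have := card_components predT; rewrite count_predT => <-.
  by apply: eq_card => C; rewrite [RHS]inE andbT.
have [hs0|[h ih]] : hs = [::] \/ exists h, h \in hs.
- by case: (hs) => [|h s]; [left|right; exists h; rewrite inE eqxx].
- by rewrite hs0 !mul0n.
congr (_ * _); rewrite /ribbon_height.
suff -> : \max_(C in components tau kappa) size (Defs.rows C) = e.+1 by rewrite subn1.
apply/eqP; rewrite eqn_leq; apply/andP; split.
  by apply/bigmax_leqP => C; rewrite mem_components => /mapP[h' ih' ->]; rewrite size_rows.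
rewrite -(size_rows ih).
apply: (@leq_bigmax_cond _ (fun C => C \in components tau kappa) (fun C => size (Defs.rows C))).
by rewrite mem_components map_f.
Qed.

Lemma first_row_ribbons (z : nat) :
  (exists2 C, C \in components tau kappa & is_first_row z C) <-> z \in hs.
Proof.
split=> [[C]|iz].
  rewrite mem_components => /mapP[h ih ->] /andP[].
  rewrite ribbon_row // => zr /allP /(_ h); rewrite ribbon_row // => zh.
  by suff -> : z = h by []; have := zh ltac:(lia); lia.
exists (ribbon z); first by rewrite mem_components map_f.
rewrite /is_first_row ribbon_row //; apply/andP; split; first by lia.
by apply/allP => r; rewrite ribbon_row //; lia.
Qed.

End Ribbons.

(** * A ladder gives a strong cover *)

Local Open Scope nat_scope.

Section LadderCover.
Variables (K : nat) (kappa : seq nat).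
Hypothesis ck : is_core K.+1 kappa.
Local Notation mu := (nth 0 (pcore K kappa)).
Local Notation kap := (nth 0 kappa).
Local Notation dn := (down K.+1 mu).

Lemma pcore_mono i j : i <= j -> mu j <= mu i.
Proof. exact: core_mono. Qed.

Lemma pcore_lt i : mu i < K.+1.
Proof. by case: (core_rec i ck). Qed.

Lemma kap_rec r : kap r = mu r + kap (dn r).
Proof. by case: (core_rec r ck). Qed.

Lemma kap_mono i j : i <= j -> kap j <= kap i.
Proof. by apply: nth_part; case: ck. Qed.

Variables (e y u : nat) (hs : seq nat).
Hypothesis mu_y : 0 < mu y.
Hypothesis flat_y : flat mu e y.
Hypothesis drop_y : mu (y + e).+1 < mu y.
Hypothesis y_dn : y + e < dn y.
Hypothesis lad : ladder K.+1 mu e y hs u.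

(** The common width of the ribbons, read off at the lowest one: row y of kappa ends at mu y + kap
    (dn y), and row y + e of the inner core at mu y - 1 + kap (dn y + e + 1). *)
Let delta := (kap (dn y) - kap (dn y + e).+1).+1.

(* The rows of kappa after removing a ribbon of height e + 1 starting in each
   row of hs. *)
Definition ladder_inside (r : nat) : nat :=
  if has (fun h => h <= r < h + e) hs then (kap r.+1).-1
  else if (e <= r) && (r - e \in hs) then kap (r - e) - delta else kap r.

Local Notation tau := ladder_inside.
Local Notation lam := (block_shift mu e y u).

Let gap : pairwise (fun h h' => h' + e < h) hs.
Proof. by have [] := ladder_props pcore_mono pcore_lt lad y_dn. Qed.

Let hs_le (h : nat) : h \in hs -> h <= y /\ h + e < dn h.
Proof. by have [_ + _ _] := ladder_props pcore_mono pcore_lt lad y_dn; exact. Qed.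

Let hs_flat (h : nat) : h \in hs -> flat mu e h /\ (h = y \/ dn h \in hs).
Proof. by have [_ _ + _] := ladder_props pcore_mono pcore_lt lad y_dn; exact. Qed.

Let hs_u (h : nat) : h \in hs -> 0 < e -> u + e <= h.
Proof. by have [_ _ _] := ladder_props pcore_mono pcore_lt lad y_dn; exact. Qed.

Let y_hs : y \in hs. Proof. exact: ladder_mem lad. Qed.

Lemma kap_pos i : i <= e -> 0 < kap (y + i).
Proof. by move=> ie; rewrite kap_rec flat_y //; lia. Qed.

Lemma kap_pos_hs (h i : nat) : h \in hs -> i <= e -> 0 < kap (h + i).
Proof.
move=> ih ie; have [hy _] := hs_le ih; apply: leq_trans (kap_pos ie) _.
by apply: kap_mono; lia.
Qed.

Lemma kap_delta (h : nat) : h \in hs -> delta <= kap h.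
Proof.
move=> ih; have [hy _] := hs_le ih; apply: leq_trans (kap_mono hy).
by rewrite kap_rec /delta; lia.
Qed.

Lemma inside_in (h i : nat) : h \in hs -> i < e -> tau (h + i) = (kap (h + i).+1).-1.
Proof.
move=> ih ie; rewrite /tau (_ : has _ _ = true) //.
by apply/hasP; exists h => //; lia.
Qed.

Lemma inside_end (h : nat) : h \in hs -> tau (h + e) = kap h - delta.
Proof.
move=> ih; rewrite /tau (_ : has _ _ = false).
  by rewrite addnK ih leq_addl.
apply/hasPn => h' ih'; apply/negP => hh.
suff E : h' = h by move: hh; rewrite E; lia.
by apply: (gap_uniq gap ih' ih (r := h + e)); lia.
Qed.

Lemma inside_out (r : nat) : (forall h : nat, h \in hs -> ~~ (h <= r <= h + e)) -> tau r = kap r.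
Proof.
move=> nr; rewrite /tau (_ : has _ _ = false).
  case: ifP => // /andP[er ir]; have := nr _ ir; lia.
by apply/hasPn => h /nr; lia.
Qed.

Lemma inside_cases (r : nat) : (exists h i, [/\ h \in hs, i < e & r = h + i]) \/
  (exists2 h, h \in hs & r = h + e) \/ (forall h : nat, h \in hs -> ~~ (h <= r <= h + e)).
Proof.
have [/hasP[h ih hr]|/hasPn nr] := boolP (has (fun h => h <= r <= h + e) hs); last by right; right.
have [re|re] := eqVneq r (h + e); first by right; left; exists h.
by left; exists h, (r - h); split=> //; lia.
Qed.

(** Along the path each ribbon is a copy of the next one. At y the lost unit moves the jump one row
    down, below all ribbons. At rows u, ..., u + e - 1, which feed the top ribbon, the gained unit
    moves it one row up, matching the cut [(kap r.+1).-1]. By [ladder_pre] no other row jumps into a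
    ribbon. *)
Lemma inside_rec r : tau r = lam r + tau (r + K.+1 - lam r).
Proof.
have mr := pcore_lt r.
case: (inside_cases r) => [[h [i [ih ie ->]]]|[[h ih ->]|nr]].
- have [hy hd] := hs_le ih; have [fh hx] := hs_flat ih; rewrite inside_in //.
  have hu : u + e <= h by apply: hs_u => //; lia.
  have kh : kap (h + i).+1 = mu h + kap (dn h + i.+1).
    rewrite -addnS kap_rec (flat_down pcore_lt fh) // fh //.
  rewrite /block_shift fh; last by lia.
  case: hx => [hy'|hx].
    subst h; have -> : y <= y + i <= y + e by lia.
    have -> : (u <= y + i < u + e) = false by lia.
    rewrite addn0; have -> : y + i + K.+1 - (mu y - true) = dn y + i.+1.
      by have := pcore_lt y; rewrite /down; lia.
    rewrite inside_out ?kh; first by lia.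
    by move=> h /hs_le[]; lia.
  have hy' : h + e < y.
    by have [+ _] := hs_le hx; lia.
  have -> : (y <= h + i <= y + e) = false by lia.
  have -> : (u <= h + i < u + e) = false by lia.
  rewrite addn0 subn0; have -> : h + i + K.+1 - mu h = dn h + i.
    by have := pcore_lt h; rewrite /down; lia.
  rewrite inside_in // kh -addnS.
  have := kap_pos_hs hx (ie : i.+1 <= e); lia.
- have [hy hd] := hs_le ih; have [fh hx] := hs_flat ih; rewrite inside_end //.
  have hu : 0 < e -> u + e <= h by apply: hs_u.
  rewrite /block_shift fh // [kap h]kap_rec.
  have -> : (u <= h + e < u + e) = false by lia.
  rewrite addn0; case: hx => [hy'|hx].
    subst h; have -> : y <= y + e <= y + e by lia.
    have -> : y + e + K.+1 - (mu y - true) = dn y + e.+1.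
      by have := pcore_lt y; rewrite /down; lia.
    rewrite inside_out ?addnS; last by move=> h /hs_le[]; lia.
    have := kap_mono (_ : dn y <= (dn y + e).+1); rewrite /delta; lia.
  have hy' : h + e < y by have [+ _] := hs_le hx; lia.
  have -> : (y <= h + e <= y + e) = false by lia.
  rewrite subn0; have -> : h + e + K.+1 - mu h = dn h + e.
    by have := pcore_lt h; rewrite /down; lia.
  by rewrite inside_end //; have := kap_delta hx; lia.
- rewrite inside_out // /block_shift.
  have -> : (y <= r <= y + e) = false by apply: negbTE; exact: nr.
  rewrite subn0; have [/andP[ur re]|nur] := boolP (u <= r < u + e).
    have [a ia [na ha]] := ladder_summit lad.
    have ie : r - u < e by lia.
    have := ha _ ie; rewrite subnKC // => dr.
    have -> : r + K.+1 - (mu r + true) = a + (r - u).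
      by move: dr; rewrite {1}/down; lia.
    rewrite inside_in // kap_rec dr.
    have := kap_pos_hs ia (ie : (r - u).+1 <= e); rewrite addnS; lia.
  rewrite addn0 inside_out ?[LHS]kap_rec // => h ih; apply/negP => hr.
  have ie : dn r - h <= e by rewrite /down; lia.
  have dh : dn r = h + (dn r - h) by rewrite /down; lia.
  case: (ladder_pre pcore_mono pcore_lt lad ih ie dh) => [[h' ih' rh']|[h0 rh]].
    by have := nr _ ih'; rewrite rh'; lia.
  by move: nur; lia.
Qed.

Lemma shift_le r : lam r <= K.
Proof.
have mr := pcore_lt r; rewrite /block_shift.
have [/andP[ur re]|] := boolP (u <= r < u + e); last by lia.
have [a ia [na ha]] := ladder_summit lad.
have ie : r - u < e by lia.
have := ha _ ie; rewrite subnKC // /down; have := hs_u ia; lia.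
Qed.

Lemma shift_mono i j : i <= j -> lam j <= lam i.
Proof.
suff step r : lam r.+1 <= lam r.
  by move=> ij; rewrite -(subnKC ij); elim: (j - i) => [|k IH]; rewrite ?addn0 // addnS (leq_trans (step _)).
have mr := pcore_mono (leqnSn r); rewrite /block_shift.
have hu := hs_u y_hs.
have [E|ne] := eqVneq r (y + e).
  by move: drop_y; rewrite -E -(flat_y (leqnn e)) -E; lia.
(* If mu took the same value at u - 1 and u, then [dn] would send u - 1 to the top row of the
   ladder, which has no preimage. *)
have [E|nu] := eqVneq r.+1 u; last by lia.
have [e0|e0] := posnP e; first by lia.
have [a ia [na ha]] := ladder_summit lad.
have := ha _ e0; rewrite addn0 -E => dr; have := na r; move: dr; rewrite /down.
by have := pcore_lt r; have := pcore_lt r.+1; lia.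
Qed.

Lemma shift_out L r : size (pcore K kappa) <= L -> L <= r -> lam r = 0.
Proof.
move=> sL Lr; have mr i : L <= i -> mu i = 0 by move=> Li; rewrite nth_default //; lia.
rewrite /block_shift mr //.
suff : r >= u + e \/ e = 0 by lia.
have [e0|e0] := posnP e; [by right|left].
have hu := hs_u y_hs e0; have : y < L by rewrite ltnNge; apply/negP => /mr; lia.
lia.
Qed.

Lemma inside_core : exists2 s, is_core K.+1 s /\ nth 0 (pcore K s) =1 lam & nth 0 s =1 tau.
Proof.
have [s cs ps] := core_exists shift_mono shift_le (fun r => @shift_out _ r (leqnn _)).
exists s => //; apply: (rec_uniq (L := size s + size kappa + (y + e).+1) shift_le).
- by move=> r; case: (core_rec r cs); rewrite ps.
- exact: inside_rec.
- by move=> r rs; rewrite nth_default //; lia.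
- move=> r rs; rewrite inside_out; first by rewrite nth_default //; lia.
  by move=> h /hs_le[]; lia.
Qed.

(** These inequalities make the last row of a ribbon nonempty and separate it from the row below. At
    y they come from the choice of [delta] and from [drop_y]; the recurrence carries them up the
    ladder. *)
Lemma kap_block (h : nat) : h \in hs ->
  kap h < kap (h + e) + delta /\ kap (h + e).+1 + delta <= kap h.
Proof.
move: {2}(y - h) (leqnn (y - h)) => d; elim/ltn_ind: d h => d IH h hd ih.
have [hy _] := hs_le ih; have [fh hx] := hs_flat ih.
have -> : kap (h + e) = mu h + kap (dn h + e).
  by rewrite kap_rec (flat_down pcore_lt fh) // fh.
rewrite [kap h]kap_rec [kap (h + e).+1]kap_rec.
case: hx => [E|hx].
  subst h; have := kap_mono (leqnSn (dn y + e)).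
  have := kap_mono (_ : dn y <= (dn y + e).+1).
  have := @kap_mono (dn y + e).+1 (dn (y + e).+1).
  have := pcore_lt y; move: drop_y; rewrite /delta /down; lia.
have := pcore_mono (_ : h <= (h + e).+1); have dh := down_gt pcore_lt h.
have [hy2 _] := hs_le hx.
case: (IH (y - dn h) _ (dn h) (leqnn _) hx) => [|l1 l2]; first lia.
have := @kap_mono (dn h + e).+1 (dn (h + e).+1).
have := down_add pcore_mono pcore_lt h e.+1; rewrite !addnS; lia.
Qed.

Lemma inside_lt (h r : nat) : h \in hs -> h <= r <= h + e -> tau r < kap r.
Proof.
move=> ih hr; have [re|re] := eqVneq r (h + e); last first.
  have ie : r - h < e by lia.
  have := inside_in ih ie; have := kap_pos_hs ih (ie : (r - h).+1 <= e).
  by rewrite addnS subnKC; last lia; have := kap_mono (leqnSn r); lia.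
by rewrite re inside_end //; have [] := kap_block ih; have := kap_delta ih; lia.
Qed.

Lemma inside_le r : tau r <= kap r.
Proof.
case: (inside_cases r) => [[h [i [ih ie ->]]]|[[h ih ->]|nr]].
- by apply/ltnW/(inside_lt ih); lia.
- by apply/ltnW/(inside_lt ih); lia.
- by rewrite inside_out.
Qed.

Lemma sum_interval a m L : a + m <= L -> \sum_(r < L) (a <= r < a + m) = m.
Proof.
move=> aL; rewrite -(big_mkord xpredT (fun r => (a <= r < a + m) : nat)).
rewrite (big_cat_nat (n := a)) //=; last by lia.
rewrite (big_cat_nat (m := a) (n := a + m)) //=; last by lia.
rewrite big_nat_cond big1 ?add0n; last by move=> i /andP[/andP[]]; lia.
rewrite [X in _ + X]big_nat_cond [X in _ + X]big1 ?addn0; last by move=> i /andP[/andP[]]; lia.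
rewrite big_nat_cond (eq_bigr (fun=> 1)); last by move=> i /andP[/andP[? ?] _]; lia.
by rewrite -big_nat_cond sum_nat_const_nat; lia.
Qed.

Variable s : seq nat.
Hypothesis cs : is_core K.+1 s.
Hypothesis ps : nth 0 (pcore K s) =1 lam.

Lemma nth_inside r : nth 0 s r = tau r.
Proof.
have [s' [cs' ps'] <-] := inside_core.
by rewrite (core_inj cs cs') // => i; rewrite ps ps'.
Qed.

Lemma ladder_strong_cover : strong_cover K s kappa.
Proof.
split=> //.
  apply/fsubsetP => -[r c]; rewrite !mem_diagram nth_inside => h.
  exact: leq_trans h (inside_le r).
set L := size (pcore K s) + size (pcore K kappa) + (y + e).+1 + u + e.
rewrite (@sumn_nth _ L); last by rewrite /L; lia.
rewrite (@sumn_nth (pcore K kappa) L); last by rewrite /L; lia.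
have key : \sum_(r < L) nth 0 (pcore K s) r + \sum_(r < L) (y <= r < y + e.+1) =
    \sum_(r < L) mu r + \sum_(r < L) (u <= r < u + e).
  rewrite -!big_split; apply: eq_bigr => r _ /=; rewrite ps /block_shift.
  have [/andP[yr re]|] := boolP (y <= r <= y + e); last by lia.
  by have := flat_y (_ : r - y <= e); rewrite subnKC //; lia.
by move: key; rewrite !sum_interval /L; lia.
Qed.

Let skew_rows (r c : nat) : nth 0 s r <= c < kap r -> exists2 h : nat, h \in hs & h <= r <= h + e.
Proof.
rewrite nth_inside => rc.
case: (inside_cases r) => [[h [i [ih ie ->]]]|[[h ih ->]|nr]].
- by exists h => //; lia.
- by exists h => //; lia.
- by move: rc; rewrite inside_out //; lia.
Qed.

Let skew_nonempty (h r : nat) : h \in hs -> h <= r <= h + e -> nth 0 s r < kap r.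
Proof. by rewrite nth_inside; exact: inside_lt. Qed.

Let skew_linked (h i : nat) : h \in hs -> i < e ->
  nth 0 s (h + i).+1 <= nth 0 s (h + i) < kap (h + i).+1.
Proof.
move=> ih ie; rewrite nth_part //=; last by case: cs.
by rewrite nth_inside inside_in //; have := kap_pos_hs ih ie; rewrite addnS; lia.
Qed.

Let skew_separated (h : nat) : h \in hs -> kap (h + e).+1 <= nth 0 s (h + e).
Proof.
by move=> ih; rewrite nth_inside inside_end //; have [_] := kap_block ih; lia.
Qed.

Lemma ladder_spin (z : nat) : cover_spin s kappa z = size hs * e + count (ltn z) hs.
Proof. exact: cover_spin_ribbons. Qed.

Lemma ladder_marks (z : nat) :
  (exists2 C, C \in components s kappa & is_first_row z C) <-> z \in hs.
Proof. exact: (first_row_ribbons gap). Qed.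

End LadderCover.

(** * Cores below a ladder cover *)

Local Open Scope ring_scope.

Lemma int_max (P : int -> Prop) (B z : int) : P z -> (forall w, P w -> w <= B) ->
  exists m, [/\ P m, z <= m & forall w, P w -> w <= m].
Proof.
move=> Pz PB; move: {2}`|B - z|%N (leqnn `|B - z|%N) => d.
elim: d z Pz => [|d IH] z Pz zd.
  by exists z; split=> // w /PB; have := PB _ Pz; lia.
have [[w [Pw zw]]|n] := pselect (exists w, P w /\ z < w).
  have [|m [Pm wm mm]] := IH w Pw; first by have := PB _ Pw; lia.
  by exists m; split=> //; lia.
exists z; split=> // w Pw; rewrite leNgt; apply/negP => zw; apply: n; by exists w.
Qed.

Section Beads.
Variable (g : nat -> nat).
Hypothesis mono : forall i j, (i <= j)%N -> (g j <= g i)%N.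

(** The bead of row r on the abacus. The bead set of an n-core is closed under x -> x - n, and the
    bounce from r leads to the row of the bead n places lower. *)
Definition bead_pos (r : nat) : int := (g r)%:Z - r%:Z.

Definition bead (x : int) : Prop := exists r, x = bead_pos r.

Lemma bead_posD r k : bead_pos (r + k) <= bead_pos r - k%:Z.
Proof. by have := mono (leq_addr k r); rewrite /bead_pos; lia. Qed.

Lemma bead_pos_lt r r' : (bead_pos r' < bead_pos r) = (r < r')%N.
Proof.
case: (ltnP r r') => h; [apply/idP|apply/negbTE].
  by have := bead_posD r (r' - r); rewrite subnKC; lia.
by have := bead_posD r' (r - r'); rewrite subnKC; lia.
Qed.

Lemma bead_pos_inj : injective bead_pos.
Proof.
move=> r r' E; have := bead_pos_lt r r'; have := bead_pos_lt r' r; rewrite E ltxx; lia.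
Qed.

Lemma bead_next r x : bead x -> x < bead_pos r -> x <= bead_pos r.+1.
Proof.
move=> [r' ->]; rewrite bead_pos_lt => rr'.
by have := bead_posD r.+1 (r' - r.+1); rewrite subnKC; lia.
Qed.

End Beads.

Lemma flushM n (g : nat -> nat) : (forall x, bead g x -> bead g (x - n%:Z)) ->
  forall x j, bead g x -> bead g (x - (j * n)%:Z).
Proof.
move=> fl x; elim=> [|j IH] bx; first by rewrite mul0n subr0.
by have := fl _ (IH bx); congr (bead g _); lia.
Qed.

(** * Bead exchanges between two nested cores *)

Section Completeness.
Variables (n L : nat) (t k : nat -> nat).
Hypothesis n0 : (0 < n)%N.
Hypothesis t_mono : forall i j, (i <= j)%N -> (t j <= t i)%N.
Hypothesis k_mono : forall i j, (i <= j)%N -> (k j <= k i)%N.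
Hypothesis t0 : forall r, (L <= r)%N -> t r = 0%N.
Hypothesis k0 : forall r, (L <= r)%N -> k r = 0%N.
Hypothesis tk : forall r, (t r <= k r)%N.
Hypothesis t_flush : forall x, bead t x -> bead t (x - n%:Z).
Hypothesis k_flush : forall x, bead k x -> bead k (x - n%:Z).

Local Notation bt := (bead_pos t).
Local Notation bk := (bead_pos k).

(* The diagonal of content z - 1 meets the skew shape. *)
Definition differ (z : int) : Prop := exists r, bt r < z <= bk r.

Lemma differ_bottom z : differ (z + 1) -> ~ differ z -> bead t z /\ ~ bead k z.
Proof.
move=> [r rz] nd; have tz : bt r = z.
  apply/eqP; rewrite eq_le; apply/andP; split; first by lia.
  by rewrite leNgt; apply/negP => h; apply: nd; exists r; lia.
split; first by exists r.
move=> [s sz]; apply: nd; exists s; rewrite -sz lexx andbT -tz bead_pos_lt //.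
by rewrite -(bead_pos_lt k_mono) -sz; lia.
Qed.

Lemma differ_top z : differ z -> ~ differ (z + 1) -> bead k z /\ ~ bead t z.
Proof.
move=> [r rz] nd; have kz : bk r = z.
  apply/eqP; rewrite eq_le; apply/andP; split; last by lia.
  by rewrite leNgt; apply/negP => h; apply: nd; exists r; lia.
split; first by exists r.
move=> [s sz]; apply: nd; exists s; rewrite -sz ltzD1 lexx -kz /=.
rewrite -ltzD1 ltrD2r bead_pos_lt //.
by rewrite -(bead_pos_lt t_mono) -sz; lia.
Qed.

Lemma differ_tau z : bead t z -> ~ bead k z -> differ (z + 1).
Proof.
move=> [r rz] nk; exists r; rewrite rz; apply/andP; split; first by lia.
have := tk r; have : bk r <> z by move=> E; apply: nk; exists r.
by rewrite rz /bead_pos; lia.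
Qed.

Lemma differ_kappa z : bead k z -> ~ bead t z -> differ z.
Proof.
move=> [r rz] nk; exists r; rewrite rz; apply/andP; split; last by lia.
have := tk r; have : bt r <> z by move=> E; apply: nk; exists r.
by rewrite rz /bead_pos; lia.
Qed.

Lemma differ_le z : differ z -> z <= (k 0)%:Z.
Proof. by move=> [r]; have := k_mono (leq0n r); rewrite /bead_pos; lia. Qed.

Lemma differ_gt z : differ z -> - L%:Z < z.
Proof.
move=> [r]; have [Lr|rL] := leqP L r; last by rewrite /bead_pos; lia.
by rewrite /bead_pos t0 ?k0 //; lia.
Qed.

Definition top_bead (x : int) := bead k x /\ ~ bead k (x + n%:Z).

Lemma top_bead_ex x : bead k x -> exists j, top_bead (x + (j * n)%:Z).
Proof.
move=> kx; pose above w := exists2 j : nat, w = x + (j * n)%:Z & bead k w.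
have [|w [j jw]|m [[j jm km] _ mx]] := @int_max above (k 0)%:Z x.
- by exists 0%N; rewrite // mul0n addr0.
- by move=> [r ->]; have := k_mono (leq0n r); rewrite /bead_pos; lia.
exists j; rewrite -jm; split=> // km1.
have : m + n%:Z <= m by apply: mx; exists j.+1 => //; rewrite jm mulSn; lia.
by lia.
Qed.

(* Moving the c topmost beads of the runner of p down by q positions, onto the
   runner whose top bead is p - q - c n, keeps the shape above t. *)
Definition exchange (p : int) (q c : nat) : Prop :=
  [/\ (0 < q < n)%N, (0 < c)%N, top_bead p, top_bead (p - q%:Z - (c * n)%:Z) &
      forall (a : nat) (z : int), (a < c)%N -> p - (a * n)%:Z - q%:Z < z <= p - (a * n)%:Z -> differ z].

(** Let p be the largest differing place and z0 the largest place below it that does not differ; z0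
    is a bead of t and not of k. All z0 - m n are beads of t, and M is the first m for which this is
    also a bead of k. Going down from m = 0 to M - 1, one keeps a stretch of length o above every z0
    - m n inside the differing places, shortening it when necessary. The runner through its end
    supplies the beads to be moved. *)
Lemma exchange_ex : (exists r, t r <> k r) -> exists p q c, exchange p q c.
Proof.
move=> [r0 tk0].
have [||p [dp _ pmax]] := @int_max differ (k 0)%:Z (bk r0).
- by exists r0; have := tk r0; rewrite /bead_pos; lia.
- exact: differ_le.
have [kp ntp] : bead k p /\ ~ bead t p.
  by apply: differ_top => // /pmax; lia.
have [||m [[nz pz] z0p zmax]] := @int_max (fun w => ~ differ w /\ w <= p) p (- L%:Z).
- split; first by move=> /differ_gt; lia.
  by have := differ_gt dp; lia.
- by move=> w [].
set z0 := m in zmax nz pz.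
have z0lt : z0 < p by rewrite lt_neqAle pz andbT; apply/eqP => E; apply: nz; rewrite E.
have dz0 (z : int) : z0 < z -> z <= p -> differ z.
  move=> z0z zp; have [//|nd] := pselect (differ z).
  by have := zmax z (conj nd zp); lia.
have [tz0 nkz0] : bead t z0 /\ ~ bead k z0.
  by apply: differ_bottom => //; apply: dz0; lia.
pose state (m : nat) := exists o j : nat, [/\ (0 < o < n)%N,
  top_bead (z0 - (m * n)%:Z + o%:Z + (j * n)%:Z),
  z0 - (m * n)%:Z + o%:Z + (j * n)%:Z <= p &
  forall (a : nat) (z : int), (a <= m)%N -> z0 - (a * n)%:Z < z <= z0 - (a * n)%:Z + o%:Z -> differ z].
have le_p (x : int) : bead k x -> ~ bead t x -> x <= p by move=> kx ntx; apply/pmax/differ_kappa.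
have [M [kM minM]] : exists M : nat, bead k (z0 - (M * n)%:Z) /\
    forall m, (m < M)%N -> ~ bead k (z0 - (m * n)%:Z).
  have ex : exists M : nat, `[< bead k (z0 - (M * n)%:Z) >].
    exists (`|z0|%N + L)%N; apply/asboolP; exists (`|z0 - ((`|z0|%N + L) * n)%:Z|%N)%N.
    have : ((`|z0|%N + L)%N * n >= `|z0|%N + L)%N by rewrite leq_pmulr.
    by move=> h; rewrite /bead_pos k0; lia.
  exists (ex_minn ex); case: ex_minnP => M /asboolP kM min; split=> // m' mM km.
  by have := min m' (asboolT km); lia.
have M0 : (0 < M)%N by case: (M) kM => //; rewrite mul0n subr0.
have states m' : (m' < M)%N -> state m'.
  elim: m' => [_|m' IH mM].
    have E := divn_eq (absz (p - z0)%R) n; set o := (absz (p - z0)%R %% n)%N in E.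
    set j := (absz (p - z0)%R %/ n)%N in E.
    have pE : p = z0 + o%:Z + (j * n)%:Z by lia.
    exists o, j; rewrite mul0n subr0 -pE; split=> //.
    - rewrite ltn_mod n0 andbT lt0n; apply/eqP => o0; apply: nkz0.
      by have := flushM k_flush j kp; congr (bead k _); lia.
    - split=> // kpn; have : p + n%:Z <= p; last by lia.
      apply: le_p => // /t_flush; rewrite addrK; exact: ntp.
    - by move=> a z; rewrite leqn0 => /eqP ->; rewrite mul0n subr0 => zz; apply: dz0; lia.
  have [o [j [o0 topj jp dl]]] := IH (ltnW mM).
  pose z1 : int := z0 - (m'.+1 * n)%:Z; have nk1 : ~ bead k z1 by exact: minM.
  have t1 : bead t z1 by apply: (flushM t_flush).
  have d1 := differ_tau t1 nk1.
  have [all1|nall] := pselect (forall z : int, z1 < z <= z1 + o%:Z -> differ z).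
    exists o, j.+1; split=> //.
    - by move: topj; congr top_bead; rewrite !mulSn; lia.
    - by move: jp; rewrite !mulSn; lia.
    - by move=> a z; rewrite leq_eqVlt => /orP[/eqP->|/dl]; [exact: all1|exact].
  (* The stretch breaks here. The place z1 + o' before the first break is a bead of k and not of t,
     and its runner replaces the previous one with a smaller offset. *)
  have exo : exists o', `[< (0 < o')%N /\ ~ differ (z1 + 1 + o'%:Z) >].
    have [z [zz nd]] : exists z : int, z1 < z <= z1 + o%:Z /\ ~ differ z.
      apply: contrapT => ne; apply: nall => z zz; apply: contrapT => nd; apply: ne.
      by exists z.
    exists (absz (z - z1 - 1)%R); apply/asboolP.
    have -> : z1 + 1 + (absz (z - z1 - 1)%R)%:Z = z by lia.
    split=> //; rewrite lt0n; apply/eqP => E; apply: nd.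
    by have -> : z = z1 + 1 by lia.
  case: (ex_minnP exo) => o' /asboolP[o'0 nd] mino.
  have dlt i : (0 < i <= o')%N -> differ (z1 + i%:Z).
    case: i => // -[|i] io; first exact: d1.
    apply: contrapT => ndi; suff : (o' <= i.+1)%N by lia.
    by apply: mino; apply/asboolP; split=> //; move: ndi; congr (~ differ _); lia.
  have oo : (o' < o)%N.
    rewrite ltnNge; apply/negP => oo'; apply: nall => z zz.
    by have := dlt (absz (z - z1)%R); have -> : z1 + (absz (z - z1)%R)%:Z = z by [lia|]; apply; lia.
  have [kw ntw] : bead k (z1 + o'%:Z) /\ ~ bead t (z1 + o'%:Z).
    apply: differ_top; first by apply: dlt; lia.
    by move: nd; congr (~ differ _); lia.
  have [j' topj'] := top_bead_ex kw.
  exists o', j'; split=> //; first by lia.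
    apply: le_p; first by case: topj'.
    by move=> tw; apply: ntw; have := flushM t_flush j' tw; rewrite addrK.
  move=> a z; rewrite leq_eqVlt => /orP[/eqP->|am] zz; last by apply: (dl a) => //; lia.
  have := dlt (absz (z - z1)%R); have -> : z1 + (absz (z - z1)%R)%:Z = z by [lia|]; apply; lia.
have [o [j [o0 topj jp dl]]] := states M.-1 ltac:(lia).
have EM : ((M.-1 * n)%:Z = (M * n)%:Z - n%:Z).
  by rewrite -{2}(prednK M0) mulSn; lia.
exists (z0 - (M.-1 * n)%:Z + o%:Z + (j * n)%:Z), o, j.+1; split=> //.
  have -> : z0 - (M.-1 * n)%:Z + o%:Z + (j * n)%:Z - o%:Z - (j.+1 * n)%:Z = z0 - (M * n)%:Z.
    by rewrite EM mulSn; lia.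
  split=> //; have := minM M.-1 ltac:(lia); congr (~ bead k _); rewrite EM; lia.
move=> a z aj; have jE : j = (a + (j - a))%N by lia.
move: (j - a)%N jE => d jE; have dE : (j * n = a * n + d * n)%N by rewrite jE mulnDl.
(* Intervals starting above z0 lie in the stretch from z0 to p; the others are covered by the state
   reached at M - 1. *)
have [dM|Md] := leqP d M.-1; last first.
  have : (M.-1 * n <= d * n)%N by rewrite leq_mul2r; lia.
  by move=> h zz; apply: dz0; lia.
have ME : (M.-1 * n = d * n + (M.-1 - d) * n)%N by rewrite -mulnDl subnKC.
by move=> zz; apply: (dl (M.-1 - d)%N); [lia|lia].
Qed.

(* No runner crossed by the exchange has its top bead in between. *)
Definition unblocked (p : int) (q c : nat) : Prop := forall q' c' : nat,
  (0 < q' < q)%N -> (c' <= c)%N -> ~ top_bead (p - q'%:Z - (c' * n)%:Z).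

(** A blocking top bead yields an exchange with smaller q: for c' = 0 one starts from it instead of
    p, otherwise it becomes the new target. *)
Lemma exchange_unblocked p q c : exchange p q c ->
  exists p q c, exchange p q c /\ unblocked p q c.
Proof.
elim/ltn_ind: q p c => q IH p c ex.
have [ub|] := pselect (unblocked p q c); first by exists p, q, c.
move=> /existsNP[q' /existsNP[c' /not_implyP[qq' /not_implyP[cc' /contrapT tb]]]].
have [qn c0 tp tpb dl] := ex; have [c'0|c'0] := posnP c'.
  apply: (IH (q - q')%N _ (p - q'%:Z) c); first by lia.
  split=> //; first by lia.
  - by move: tb; rewrite c'0 mul0n subr0.
  - by move: tpb; congr top_bead; lia.
  - by move=> a z ac zz; apply: (dl a) => //; lia.
apply: (IH q' _ p c'); first by lia.
split=> //; first by lia.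
by move=> a z ac zz; apply: (dl a) => //; lia.
Qed.

End Completeness.

(** * From an unblocked exchange to a ladder *)

Section LadderAbove.
Variables (K : nat) (kappa tau : seq nat).
Hypothesis ck : is_core K.+1 kappa.
Hypothesis ct : is_core K.+1 tau.
Hypothesis tk : forall r, (nth 0 tau r <= nth 0 kappa r)%N.
Hypothesis neq : tau <> kappa.
Local Notation mu := (nth 0%N (pcore K kappa)).
Local Notation kap := (nth 0%N kappa).
Local Notation dn := (down K.+1 mu).
Local Notation bk := (bead_pos kap).
Local Notation bt := (bead_pos (nth 0%N tau)).
Local Notation n := K.+1.

Let kap_mono' : forall i j, (i <= j)%N -> (kap j <= kap i)%N.
Proof. exact: (kap_mono ck). Qed.

Let tau_mono : forall i j, (i <= j)%N -> (nth 0 tau j <= nth 0 tau i)%N.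
Proof. exact: (kap_mono ct). Qed.

Lemma bead_pos_down r : bk (dn r) = bk r - n%:Z.
Proof.
by have := kap_rec ck r; have := pcore_lt ck r; rewrite /bead_pos /down; lia.
Qed.

Lemma core_flush x : bead kap x -> bead kap (x - n%:Z).
Proof. by move=> [r ->]; exists (dn r); rewrite bead_pos_down. Qed.

Lemma core_exchange : exists p q c, exchange n (nth 0%N tau) kap p q c /\ unblocked n kap p q c.
Proof.
suff [p [q [c]]] : exists p q c, exchange n (nth 0%N tau) kap p q c by exact: exchange_unblocked.
apply: (@exchange_ex _ (size tau + size kappa)) => //.
- by move=> r rs; rewrite nth_default //; lia.
- by move=> r rs; rewrite nth_default //; lia.
- move=> x [r ->]; exists (down K.+1 (nth 0%N (pcore K tau)) r).
  by have := kap_rec ct r; have := pcore_lt ct r; rewrite /bead_pos /down; lia.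
- exact: core_flush.
apply: contrapT => ne; apply: neq; apply: part_ext; [by case: ct|by case: ck|].
by move=> r; apply: contrapT => h; apply: ne; exists r.
Qed.

(** Without blocking, the inner beads of the windows of length q ending at p, p - n, ..., p - c n
    form the same pattern, which recurs in the window ending at p + n. Equal patterns give equal
    parts in rows x a, ..., x a + e for a < c; the copy above p gives the rows u, ..., u + e - 1.
    The lowest moved level is y = x (c - 1). *)
Lemma ladder_above : exists e y u hs,
  [/\ (0 < mu y)%N, flat mu e y, (mu (y + e).+1 < mu y)%N, (y + e < dn y)%N &
      ladder K.+1 mu e y hs u] /\
  forall r, (nth 0 tau r <= ladder_inside K kappa e y hs r)%N.
Proof.
have [p [q [c [[qn c0 [kp nkp] [kbot nkbot] dl] ub]]]] := core_exchange.
have [x0 x0p] := kp.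
have above q' a : (0 < q' < q)%N -> (a <= c)%N -> bead kap (p - q'%:Z - (a * n)%:Z) ->
    bead kap (p - q'%:Z + n%:Z).
  move=> qq'; elim: a => [|a IH] ac bd; apply: contrapT => nb; apply: (ub q' _ qq' ac).
    by split=> //; move: nb; rewrite mul0n subr0.
  split=> // bd'; apply: nb; apply: IH; first exact: ltnW.
  by move: bd'; congr (bead _ _); rewrite mulSn; lia.
have row0 q' a : (0 < q' < q)%N -> (a <= c)%N -> bead kap (p - q'%:Z - (a * n)%:Z) ->
    bead kap (p - q'%:Z).
  by move=> h1 h2 /(above _ _ h1 h2) /core_flush; rewrite addrK.
have [e [ein eout]] : exists e, (forall i, (i <= e)%N -> p - q%:Z < bk (x0 + i)) /\
    bk (x0 + e.+1) <= p - q%:Z.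
  have ex : exists i, bk (x0 + i.+1) <= p - q%:Z.
    by exists q; have := bead_posD kap_mono' x0 q.+1; rewrite -x0p; lia.
  exists (ex_minn ex); case: ex_minnP => m mq min; split=> // -[|i] im.
    by rewrite addn0 -x0p; lia.
  by rewrite ltNge; apply/negP => /min; lia.
pose x a := iter a dn x0.
have bx a : bk (x a) = p - (a * n)%:Z.
  by elim: a => [|a IH]; rewrite /x /= ?mul0n ?subr0 -?x0p // bead_pos_down IH mulSn; lia.
have rows a : (a <= c)%N -> (forall i, (i <= e)%N -> bk (x a + i) = bk (x0 + i) - (a * n)%:Z) /\
    bk (x a + e.+1) <= p - q%:Z - (a * n)%:Z.
  move=> ac.
  have gapp i v : (i <= e)%N -> bead kap v -> v < bk (x0 + i) - (a * n)%:Z ->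
      p - q%:Z - (a * n)%:Z < v -> v <= bk (x0 + i.+1) - (a * n)%:Z.
    move=> ie bv vi vq; have xi : bk (x0 + i) <= p.
      by have := bead_posD kap_mono' x0 i; rewrite -x0p; lia.
    have vE : v = p - (absz (p - (a * n)%:Z - v)%R)%:Z - (a * n)%:Z by lia.
    rewrite vE in bv; have := row0 _ _ _ ac bv.
    rewrite addnS => /(_ ltac:(lia)) /(bead_next kap_mono' (r := x0 + i)); lia.
  have main i : (i <= e)%N -> bk (x a + i) = bk (x0 + i) - (a * n)%:Z.
    elim: i => [|i IH] ie; first by rewrite !addn0 bx -x0p.
    apply/eqP; rewrite eq_le; apply/andP; split.
      rewrite leNgt; apply/negP => lt.
      have bd : bead kap (bk (x a + i.+1)) by exists (x a + i.+1)%N.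
      have l1 : bk (x a + i.+1) < bk (x0 + i) - (a * n)%:Z.
        by rewrite -(IH (ltnW ie)) bead_pos_lt //; lia.
      have l2 : p - q%:Z - (a * n)%:Z < bk (x a + i.+1) by have := ein _ ie; lia.
      by have := gapp i _ (ltnW ie) bd l1 l2; lia.
    rewrite [(x a + _)%N]addnS; apply: (bead_next kap_mono').
      by apply: (flushM core_flush); exists (x0 + i.+1)%N.
    rewrite (IH (ltnW ie)) ltrD2r bead_pos_lt //; lia.
  split=> //; rewrite leNgt; apply/negP => lt.
  have bd : bead kap (bk (x a + e.+1)) by exists (x a + e.+1)%N.
  have l1 : bk (x a + e.+1) < bk (x0 + e) - (a * n)%:Z.
    by rewrite -main // bead_pos_lt //; lia.
  by have := gapp e _ (leqnn _) bd l1 lt; lia.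
have dnx a i : (a < c)%N -> (i <= e)%N -> dn (x a + i) = (x a.+1 + i)%N.
  move=> ac ie; apply: (bead_pos_inj kap_mono'); rewrite bead_pos_down.
  have [r1 _] := rows a (ltnW ac); have [r2 _] := rows a.+1 ac.
  by rewrite r1 // r2 // mulSn; lia.
have flatx a : (a < c)%N -> flat mu e (x a).
  move=> ac i ie; have := dnx a _ ac ie; have := dnx a 0%N ac (leq0n e); rewrite !addn0.
  by have := pcore_lt ck (x a); have := pcore_lt ck (x a + i); rewrite /down; lia.
have [u hu] : exists u, forall i, (i < e)%N -> dn (u + i) = (x0 + i).+1.
  have pre i : (i < e)%N -> exists w, dn w = (x0 + i).+1.
    move=> ie; have h1 := ein _ ie; have := bead_posD kap_mono' x0 i.+1; rewrite -x0p => h2.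
    have xE : bk (x0 + i.+1) = p - (absz (p - bk (x0 + i.+1))%R)%:Z by lia.
    have : bead kap (bk (x0 + i.+1)) by exists (x0 + i.+1)%N.
    rewrite xE => bd; have [|//||w wE] := above (absz (p - bk (x0 + i.+1))%R) 0%N.
    - by lia.
    - by rewrite mul0n subr0.
    exists w; apply: (bead_pos_inj kap_mono'); rewrite bead_pos_down -wE -addnS xE; lia.
  have [e0|e0] := posnP e; first by exists 0%N => i; rewrite e0.
  have [u uE] := pre 0%N e0; rewrite addn0 in uE; exists u; elim=> [|i IH] ie.
    by rewrite !addn0.
  have [w wE] := pre _ ie; have ui := IH (ltnW ie); rewrite -wE; congr dn.
  have l1 : (u + i < w)%N by rewrite -(down_lt (pcore_mono ck) (pcore_lt ck)) wE ui; lia.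
  have l2 : (w < u + i + 2)%N.
    rewrite -(down_lt (pcore_mono ck) (pcore_lt ck)) wE.
    by have := down_add (pcore_mono ck) (pcore_lt ck) (u + i) 2; rewrite ui; lia.
  by lia.
have lad a : (a < c)%N -> exists2 hs, ladder K.+1 mu e (x a) hs u &
    forall h : nat, h \in hs -> exists2 a', (a' <= a)%N & h = x a'.
  elim: a => [|a IH] ac.
    exists [:: x0]; last by move=> h; rewrite inE => /eqP ->; exists 0%N.
    apply: ladder_top => //; first exact: flatx 0%N ac.
    move=> w dw; apply: nkp; exists w; have := bead_pos_down w; rewrite dw -x0p; lia.
  have [hs lad hE] := IH (ltnW ac); exists (x a.+1 :: hs).
    exact: (@ladder_step _ _ _ (x a) _ _ (flatx a.+1 ac) lad).
  move=> h; rewrite inE => /orP[/eqP->|/hE[a' aa' ->]]; first by exists a.+1.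
  by exists a' => //; exact: leqW.
have c1 : (c.-1 < c)%N by lia.
have cE : c.-1.+1 = c by lia.
have [hs ladc hE] := lad _ c1; set y := x c.-1 in ladc.
have dny : dn y = x c by rewrite /y -[LHS]/(x c.-1.+1) cE.
have cn : (c * n = c.-1 * n + n)%N by rewrite -{1}cE mulSn addnC.
have [rowc lastc] := rows c (leqnn c); have [rowy lasty] := rows c.-1 (leq_pred c).
have endc : bk (x c + e.+1) = p - q%:Z - (c * n)%:Z.
  apply/eqP; rewrite eq_le lastc /= addnS; apply: (bead_next kap_mono') => //.
  by rewrite rowc // ltrD2r; exact: ein.
have y_dn : (y + e < dn y)%N.
  rewrite -(bead_pos_lt kap_mono') dny bx rowy //.
  by have := ein e (leqnn e); lia.
(* The place p - q - (c - 1) n is empty, because p - q - c n is the top bead of its runner; this is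
   what makes mu drop. *)
have drop : (mu (y + e).+1 < mu y)%N.
  have lt : bk (y + e.+1) < p - q%:Z - (c.-1 * n)%:Z.
    rewrite lt_neqAle lasty andbT; apply/eqP => E; apply: nkbot; exists (y + e.+1)%N.
    by rewrite E; lia.
  have : (dn y + e.+1 < dn (y + e.+1))%N.
    by rewrite -(bead_pos_lt kap_mono') dny endc bead_pos_down; lia.
  by have := pcore_lt ck y; have := pcore_lt ck (y + e.+1); rewrite -!addnS /down; lia.
have mu_y : (0 < mu y)%N by exact: leq_ltn_trans drop.
have fy : flat mu e y by exact: flatx.
exists e, y, u, hs; split=> // r.
(* A differing place beyond the end of row x a + i + 1 of kappa can only come from a row at or above
   x a + i, which bounds that row of tau. *)
have cross a i z : differ (nth 0%N tau) kap z -> bk (x a + i.+1) < z -> bt (x a + i) < z.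
  move=> [r' rz] bz; have : (r' < x a + i.+1)%N by rewrite -(bead_pos_lt kap_mono'); lia.
  rewrite addnS ltnS => r'x; have := bead_posD tau_mono r' (x a + i - r').
  by rewrite subnKC //; lia.
case: (inside_cases ck mu_y drop y_dn ladc r) => [[h [i [ih ie ->]]]|[[h ih ->]|nr]].
- rewrite (inside_in ck mu_y drop y_dn ladc) //.
  have [a ac ->] := hE _ ih; have [rowa _] := rows a ltac:(lia).
  have l1 := rowa _ ie; have l2 := ein _ ie; have l3 := bead_posD kap_mono' (x a) i.+1.
  have bxa := bx a.
  have := @cross a i (bk (x a + i.+1) + 1); rewrite ltzD1 lexx => /(_ _ isT).
  have d : differ (nth 0%N tau) kap (bk (x a + i.+1) + 1) by apply: (dl a); lia.
  by move=> /(_ d); rewrite /bead_pos -addnS; lia.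
- rewrite (inside_end ck mu_y drop y_dn ladc) //.
  have [a ac ->] := hE _ ih; have [_ lasta] := rows a ltac:(lia).
  have d : differ (nth 0%N tau) kap (p - (a * n)%:Z - q%:Z + 1) by apply: (dl a); lia.
  have la : bk (x a + e.+1) < p - (a * n)%:Z - q%:Z + 1 by lia.
  have := cross a e _ d la; rewrite dny; move: (bx a) (bx c) endc lasta; rewrite /bead_pos -!addnS.
  by have := kap_mono' (leq_addr e.+1 (x c)); lia.
- by rewrite (inside_out ck mu_y drop y_dn ladc).
Qed.

End LadderAbove.

(** * Strong covers as ladders *)

Local Open Scope nat_scope.

Section StrongCovers.
Variable K : nat.
Implicit Types kappa tau : seq nat.

Local Notation mu kappa := (nth 0 (pcore K kappa)).
Local Notation dn kappa := (down K.+1 (mu kappa)).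

Definition ladder_at kappa e y hs u : Prop :=
  [/\ 0 < mu kappa y, flat (mu kappa) e y, mu kappa (y + e).+1 < mu kappa y,
      y + e < dn kappa y & ladder K.+1 (mu kappa) e y hs u].

Definition ladder_cover tau kappa e y hs u : Prop :=
  [/\ ladder_at kappa e y hs u, is_core K.+1 tau &
      nth 0 (pcore K tau) =1 block_shift (mu kappa) e y u].

Lemma ladder_cover_ex kappa e y hs u : is_core K.+1 kappa -> ladder_at kappa e y hs u ->
  exists tau, ladder_cover tau kappa e y hs u.
Proof.
move=> ck lad; have [m0 fl dr yd la] := lad.
by have [s [cs ps] _] := inside_core ck m0 fl dr yd la; exists s.
Qed.

(** The inner core sigma provided by [ladder_above] has size one less; if it is not tau, the same
    argument applies to tau inside sigma. *)
Lemma core_length kappa tau : is_core K.+1 kappa -> is_core K.+1 tau ->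
  (forall r, nth 0 tau r <= nth 0 kappa r) -> tau <> kappa ->
  exists sigma, [/\ strong_cover K sigma kappa, forall r, nth 0 tau r <= nth 0 sigma r,
    exists e y hs u, ladder_cover sigma kappa e y hs u &
    sumn (pcore K tau) < sumn (pcore K kappa)].
Proof.
move: {2}(sumn _) (leqnn (sumn (pcore K kappa))) => d.
elim: d kappa => [|d IH] kappa kd ck ct tk neq.
all: have [e [y [u [hs [lad below]]]]] := ladder_above ck ct tk neq.
all: have [m0 fl dr yd la] := lad.
all: have [s [cs ps] sE] := inside_core ck m0 fl dr yd la.
all: have sc := ladder_strong_cover ck m0 fl dr yd la cs ps.
all: have [_ _ _ sums] := sc.
  by lia.
have ts r : nth 0 tau r <= nth 0 s r by rewrite sE.
exists s; split=> //; first by exists e, y, hs, u.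
have [->|neq'] := pselect (tau = s); first by rewrite -sums.
have sd : sumn (pcore K s) <= d by lia.
by have [_ [_ _ _]] := IH s sd cs ct ts neq'; lia.
Qed.

Lemma strong_cover_le tau kappa : strong_cover K tau kappa ->
  forall r, nth 0 tau r <= nth 0 kappa r.
Proof.
move=> [_ _ /fsubsetP sub _] r; rewrite leqNgt; apply/negP => lt.
by have := sub (r, nth 0 kappa r); rewrite !mem_diagram ltnn => /(_ lt).
Qed.

Lemma strong_cover_ladder tau kappa : strong_cover K tau kappa <->
  is_core K.+1 kappa /\ exists e y hs u, ladder_cover tau kappa e y hs u.
Proof.
split=> [sc|[ck [e [y [hs [u [[m0 fl dr yd la] ct pt]]]]]]]; last first.
  exact: (ladder_strong_cover ck m0 fl dr yd la ct pt).
have [ct ck _ sums] := sc; split=> //; have tk := strong_cover_le sc.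
have neq : tau <> kappa by move=> E; move: sums; rewrite E; lia.
have [s [ssc ts lad _]] := core_length ck ct tk neq.
have [->//|neq'] := pselect (tau = s).
have [_ _ _ sums'] := ssc; have [cs _ _ _] := ssc.
by have [_ [_ _ _]] := core_length cs ct ts neq'; lia.
Qed.

Lemma ladder_cover_marks tau kappa e y hs u (z : nat) : is_core K.+1 kappa ->
  ladder_cover tau kappa e y hs u ->
  [/\ (exists2 C, C \in components tau kappa & is_first_row z C) <->
        (exists k, iter k (dn kappa) z = y) &
      forall k, iter k (dn kappa) z = y ->
        cover_spin tau kappa z = size hs * e + k].
Proof.
move=> ck [[m0 fl dr yd la] ct pt].
have pm := pcore_mono ck; have pl := pcore_lt ck.
split.
  rewrite (ladder_marks ck m0 fl dr yd la ct pt); split=> [iz|[k E]].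
    by exists (count (ltn z) hs); apply: (ladder_path pm pl la yd).
  exact: (path_ladder pm pl la E).
move=> k E; rewrite (ladder_spin ck m0 fl dr yd la ct pt); congr (_ + _).
have iz := path_ladder pm pl la E.
have := ladder_path pm pl la yd iz; rewrite -E; move: (count _ _) => c.
have lt a b : a < b -> iter a (dn kappa) z < iter b (dn kappa) z.
  elim: b => // b IH; rewrite ltnS leq_eqVlt => /orP[/eqP->|/IH h] /=.
    exact: down_gt.
  by apply: ltn_trans h _; exact: down_gt.
by case: (ltngtP c k) => // /lt; lia.
Qed.

(** Flatness and the drop fix e. For e = 0 the ladder does not determine u, but [block_shift] does
    not depend on it then. *)
Lemma ladder_at_det kappa e y hs u e' hs' u' : is_core K.+1 kappa ->
  ladder_at kappa e y hs u -> ladder_at kappa e' y hs' u' ->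
  [/\ e = e', hs = hs' & block_shift (mu kappa) e y u = block_shift (mu kappa) e' y u'].
Proof.
move=> ck [m0 fl dr yd la] [_ fl' dr' yd' la'].
have E : e = e'.
  case: (ltngtP e e') => // h.
    by have := fl' e.+1 h; rewrite addnS; lia.
  by have := fl e'.+1 h; rewrite addnS; lia.
subst e'; have [-> uE] := ladder_det (pcore_mono ck) (pcore_lt ck) la la'.
split=> //; apply/funext => r; rewrite /block_shift.
by case: e uE {fl dr yd la fl' dr' yd' la'} => [|e] uE; [lia|rewrite uE].
Qed.

(** y is recovered as the first row in which the bounded partition gets smaller: the rows that gain
    a unit lie above the block that loses one. *)
Lemma ladder_cover_row tau kappa e y hs u e' y' hs' u' : is_core K.+1 kappa ->
  ladder_cover tau kappa e y hs u -> ladder_cover tau kappa e' y' hs' u' -> y = y'.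
Proof.
move=> ck.
suff key e1 y1 hs1 u1 e2 y2 hs2 u2 : ladder_cover tau kappa e1 y1 hs1 u1 ->
    ladder_cover tau kappa e2 y2 hs2 u2 -> y1 <= y2.
  by move=> l1 l2; apply/eqP; rewrite eqn_leq (key _ _ _ _ _ _ _ _ l1 l2) (key _ _ _ _ _ _ _ _ l2 l1).
move=> [[m0 fl dr yd la] _ p1] [[m0' fl' dr' yd' la'] _ p2].
have [_ _ _ hu] := ladder_props (pcore_mono ck) (pcore_lt ck) la' yd'.
have hu' := hu _ (ladder_mem la').
have := p1 y2; rewrite p2 /block_shift; lia.
Qed.

End StrongCovers.

Local Open Scope ring_scope.

(** * Marked covers of a fixed core as a sum over a bounce path *)

Section CoverSum.
Variables (R : comNzRingType) (t : R) (B l K : nat).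
Hypothesis tB : t ^+ B = 0.
Hypothesis no2 : forall x : R, x + x = 0 -> x = 0.
Variables (phi : (nat -> int) -> R) (z : nat).
Hypothesis phi_anti : forall p, (p.+1 < l)%N -> p.+1 != z -> anti p phi.
Hypothesis phi_neg : forall g, g l.-1 < 0 -> phi g = 0.
Variable kappa : seq nat.
Hypothesis ck : is_core K.+1 kappa.
Hypothesis size_kappa : (size kappa <= l)%N.
Hypothesis zl : (z < l)%N.

Local Notation mu := (nth 0%N (pcore K kappa)).
Local Notation muZ := (fun r => (mu r)%:Z).
Local Notation dn := (down K.+1 mu).
Local Notation kc := (kcat t B l K.+1 phi).

Lemma pcore_out r : (l <= r)%N -> mu r = 0%N.
Proof. by move=> lr; rewrite nth_default // size_map size_iota; lia. Qed.

Lemma catalan_neg s g : (forall b, b \in s -> b.1 <> l.-1) -> g l.-1 < 0 ->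
  catalan t B s phi g = 0.
Proof.
elim: s g => [|b s IH] g sl gl; first exact: phi_neg.
rewrite /= /geom big1 // => m _; rewrite IH ?mulr0 // => [c cs|].
  by apply: sl; rewrite inE cs orbT.
have := sl b (mem_head _ _); rewrite /root /eps => bl.
have -> : (l.-1 == b.1) = false by apply/eqP => E; apply: bl.
by case: (_ == _); rewrite /=; lia.
Qed.

Lemma kcat_neg g : g l.-1 < 0 -> kc g = 0.
Proof.
move=> gl; apply: catalan_neg => // -[i j]; rewrite mem_filter mem_pairs /=.
by move=> /andP[h /andP[il jl]] E; rewrite E in h; lia.
Qed.

Lemma kcat_ladder y : (y < l)%N -> (exists k, iter k dn z = y) ->
  (exists e hs u, ladder_at K kappa e y hs u /\
     kc (lower muZ y) = t ^+ (size hs * e) * kc (fun r => (block_shift mu e y u r)%:Z)) \/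
  ((forall e hs u, ~ ladder_at K kappa e y hs u) /\ kc (lower muZ y) = 0).
Proof.
move=> yl pz; have pm := pcore_mono ck; have pl := pcore_lt ck.
have [k0 zk] := pz.
have zy : (z <= y)%N.
  by rewrite -zk; elim: (k0) => //= j; have := down_gt pl (iter j dn z); lia.
have start e : lower muZ y = stage mu e y y 0 0.
  by apply/funext => r; rewrite /lower /eps /stage; lia.
have climbe e : (y + e < l)%N -> flat mu e y -> (y + e < dn y)%N ->
    (exists hs u, ladder K.+1 mu e y hs u /\
      kc (lower muZ y) = t ^+ (size hs * e) * kc (final mu e y u)) \/
    (kc (lower muZ y) = 0 /\ forall hs u, ~ ladder K.+1 mu e y hs u).
  move=> yel fl yd; rewrite (start e).
  apply: (climb pm pl tB no2 phi_anti yel yd fl); first by left.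
  by left.
have wide e : (y + e < l)%N -> flat mu e y -> (dn y <= y + e)%N -> kc (lower muZ y) = 0.
  by move=> yel fl yd; rewrite (start e); apply: (kcat_wide_block pm pl tB no2 phi_anti yel fl).
(* No ladder cover has its lowest block at y. The flat block reaches row l - 1, so either the bounce
   lands in it, or the climb gives 0, or it ends at a weight negative in row l - 1, where [kcat_neg]
   applies. *)
have [m0|m0] := posnP (mu y).
  right; split; first by move=> e hs u []; rewrite m0.
  have yel : (y + (l.-1 - y) < l)%N by lia.
  have fl : flat mu (l.-1 - y) y by move=> i _; have := pm _ _ (leq_addr i y); lia.
  have [yd|yd] := leqP (dn y) (y + (l.-1 - y)); first exact: (wide (l.-1 - y)%N).
  have [[hs [u [la ->]]]|[]//] := climbe _ yel fl yd.
  rewrite kcat_neg ?mulr0 // /final.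
  have [_ _ _ hu] := ladder_props pm pl la yd; have := hu _ (ladder_mem la).
  have ml : mu l.-1 = 0%N by have := pm y l.-1; lia.
  by rewrite ml; lia.
have ex : exists i, (mu (y + i.+1) < mu y)%N.
  by exists (l - y)%N; rewrite pcore_out //; lia.
have [e [dr fl]] : exists e, (mu (y + e).+1 < mu y)%N /\ flat mu e y.
  exists (ex_minn ex); case: ex_minnP => e dr min; split; first by rewrite -addnS.
  case=> [|i] ie; first by rewrite addn0.
  apply/eqP; rewrite eqn_leq pm ?leq_addr //= leqNgt; apply/negP => /min; lia.
have yel : (y + e < l)%N.
  rewrite ltnNge; apply/negP => /pcore_out; rewrite fl //; lia.
have uniq_e e' hs u : ladder_at K kappa e' y hs u -> e' = e.
  move=> [_ fl' dr' _ _]; case: (ltngtP e e') => // h.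
    by have := fl' e.+1 h; rewrite addnS; lia.
  by have := fl e'.+1 h; rewrite addnS; lia.
have [yd|yd] := leqP (dn y) (y + e).
  right; split; last exact: wide yd.
  move=> e' hs u la; have E := uniq_e _ _ _ la; subst e'.
  by case: la => _ _ _; lia.
have [[hs [u [la ->]]]|[E nl]] := climbe _ yel fl yd; last first.
  right; split=> // e' hs u la; have E' := uniq_e _ _ _ la; subst e'.
  by case: la => _ _ _ _ /nl.
left; exists e, hs, u; split=> //; congr (_ * kc _); apply/funext => r.
rewrite /final /block_shift.
have [_ _ _ hu] := ladder_props pm pl la yd; have := hu _ (ladder_mem la).
have [/andP[yr re]|] := boolP (y <= r <= y + e)%N; last by lia.
by have := fl (r - y)%N; rewrite subnKC //; lia.
Qed.

Lemma path_sum d w : (l - w <= d)%N -> (w < l)%N ->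
  catalan t B (roots l K.+1 muZ) phi (lower muZ w) =
  \sum_(k < d | (iter k dn w < l)%N) t ^+ k * kc (lower muZ (iter k dn w)).
Proof.
elim: d w => [|d IH] w wd wl; first by lia.
rewrite big_mkcond big_ord_recl /= wl expr0 mul1r.
have dE : w%:Z + K.+1%:Z - muZ w = (dn w)%:Z.
  by have := pcore_lt ck w; rewrite /down; lia.
have := down_gt (pcore_lt ck) w => wdn.
have [dl|ld] := ltnP (dn w) l.
  rewrite (kcat_lower tB _ wl dl dE) IH //; last by lia.
  congr (_ + _); rewrite mulr_sumr [LHS]big_mkcond; apply: eq_bigr => i _ /=.
  by rewrite add0n -iterS iterSr exprS mulrA.
rewrite kcat_lower_last //; last by rewrite dE; lia.
rewrite big1 ?addr0 // => i _; case: ifP => // h; exfalso; move: h.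
rewrite add0n -iterS iterSr; suff : (dn w <= iter i dn (dn w))%N by lia.
by elim: (nat_of_ord i) => //= j; have := down_gt (pcore_lt ck) (iter j dn (dn w)); lia.
Qed.

(** The list and the sum are built together along the bounce path, as [kcat_ladder] decides at each
    point whether there is a cover. Different points give different covers by [ladder_cover_row]. *)
Lemma cover_list_sum d : exists s : seq (seq nat), [/\ uniq s,
  forall tau, tau \in s <-> exists k e y hs u,
    [/\ (k < d)%N, (y < l)%N, iter k dn z = y & ladder_cover K tau kappa e y hs u] &
  \sum_(k < d | (iter k dn z < l)%N) t ^+ k * kc (lower muZ (iter k dn z)) =
  \sum_(tau <- s) t ^+ cover_spin tau kappa z * kc (fun r => (nth 0%N (pcore K tau) r)%:Z)].
Proof.
elim: d => [|d [s [us ms ss]]].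
  exists [::]; split=> //; last by rewrite big_ord0 big_nil.
  by move=> tau; split=> // -[k [e [y [hs [u []]]]]].
set y := iter d dn z.
have skip : (forall tau e hs u, (y < l)%N -> ~ ladder_cover K tau kappa e y hs u) ->
    forall tau, tau \in s <-> exists k e y hs u,
    [/\ (k < d.+1)%N, (y < l)%N, iter k dn z = y & ladder_cover K tau kappa e y hs u].
  move=> no tau; rewrite ms; split=> -[k [e [y' [hs [u [kd yl ky lc]]]]]].
    by exists k, e, y', hs, u; split=> //; lia.
  exists k, e, y', hs, u; split=> //; rewrite ltn_neqAle -ltnS kd andbT.
  by apply/eqP => E; move: ky yl lc; rewrite E => <- yl /no; apply.
rewrite big_mkcond big_ord_recr /= -big_mkcond -/y.
have [yl|ly] := ltnP y l; last first.
  by exists s; split=> //; [apply: skip; lia|rewrite addr0].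
have [[e [hs [u [lad kE]]]]|[nl kE]] := kcat_ladder yl (ex_intro _ d erefl); last first.
  exists s; split=> //; last by rewrite kE mulr0 addr0.
  by apply: skip => tau e hs u _ [/nl].
have [tau lc] := ladder_cover_ex ck lad.
exists (rcons s tau); split.
- rewrite rcons_uniq us andbT; apply/negP => /ms[k [e' [y' [hs' [u' [kd y'l ky lc']]]]]].
  have yy := ladder_cover_row ck lc lc'.
  have lt a b : (a < b)%N -> (iter a dn z < iter b dn z)%N.
    elim: b => // b IH; rewrite ltnS leq_eqVlt => /orP[/eqP->|/IH h] /=.
      exact: (down_gt (pcore_lt ck)).
    by apply: ltn_trans h _; exact: (down_gt (pcore_lt ck)).
  by have := lt _ _ kd; rewrite ky -yy /y ltnn.
- move=> tau'; rewrite mem_rcons inE; split.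
    case/orP => [/eqP->|/ms[k [e' [y' [hs' [u' [kd y'l ky lc']]]]]]].
      by exists d, e, y, hs, u.
    by exists k, e', y', hs', u'; split=> //; lia.
  move=> [k [e' [y' [hs' [u' [kd y'l ky lc']]]]]].
  have [kd'|dk] := ltnP k d.
    by apply/orP; right; apply/ms; exists k, e', y', hs', u'.
  have E : k = d by lia.
  subst k; move: lc'; rewrite -ky -/y => lc'.
  have [lad' ct' pt'] := lc'; have [_ ct pt] := lc.
  have [_ _ bE] := ladder_at_det ck lad lad'.
  apply/orP; left; apply/eqP; apply: (core_inj ct' ct) => r.
  by rewrite pt' pt bE.
- rewrite -cats1 big_cat big_seq1 /= ss; congr (_ + _).
  have [_ sp] := ladder_cover_marks z ck lc; rewrite (sp d erefl) kE addnC exprD mulrA.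
  have [_ _ pt] := lc; congr (_ * kc _); apply/funext => r; by rewrite pt.
Qed.

Lemma marked_cover_path tau : strong_marked_cover K tau z kappa <->
  exists k e y hs u,
    [/\ (k < l)%N, (y < l)%N, iter k dn z = y & ladder_cover K tau kappa e y hs u].
Proof.
split=> [[sc mk]|[k [e [y [hs [u [kl yl ky lc]]]]]]]; last first.
  split; first by apply/strong_cover_ladder; split=> //; exists e, y, hs, u.
  by apply/(proj1 (ladder_cover_marks z ck lc)); exists k.
have [_ [e [y [hs [u lc]]]]] := (strong_cover_ladder _ _ _).1 sc.
have [[+ _] _] := ladder_cover_marks z ck lc => /(_ mk)[k ky].
have yl : (y < l)%N.
  have [[m0 _ _ _ _] _ _] := lc; rewrite ltnNge; apply/negP => /pcore_out; lia.
exists k, e, y, hs, u; split=> //; apply: leq_ltn_trans yl.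
by rewrite -ky; elim: (k) => //= j; have := down_gt (pcore_lt ck) (iter j dn z); lia.
Qed.

Lemma marked_cover_sum (s : seq (seq nat)) : uniq s ->
  (forall tau, tau \in s <-> strong_marked_cover K tau z kappa) ->
  catalan t B (roots l K.+1 muZ) phi (lower muZ z) =
  \sum_(tau <- s) t ^+ cover_spin tau kappa z * kc (fun r => (nth 0%N (pcore K tau) r)%:Z).
Proof.
move=> us ms; have [s' [us' ms' E]] := cover_list_sum l.
rewrite (path_sum (leq_subr z l) zl) E; apply: perm_big; apply: uniq_perm => // tau.
by apply/idP/idP => [/ms'/marked_cover_path/ms|/ms/marked_cover_path/ms'].
Qed.

End CoverSum.

Lemma marked_covers_finite K kappa z : is_core K.+1 kappa ->
  exists s : seq (seq nat), uniq s /\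
    forall tau, tau \in s <-> strong_marked_cover K tau z kappa.
Proof.
move=> ck; set l := (size kappa + z.+1)%N.
have sl : (size kappa <= l)%N by rewrite leq_addr.
have zl : (z < l)%N by rewrite /l; lia.
have no2 (x : int) : x + x = 0 -> x = 0 by lia.
have an p : (p.+1 < l)%N -> p.+1 != z -> anti p (fun _ => 0 : int).
  by move=> _ _ g; rewrite oppr0.
(* The zero functional over the integers, with t = 0 and B = 1, meets the hypotheses; only the list
   is kept. *)
have [s [us ms _]] := @cover_list_sum int 0 1 l K (expr0n _ 1) no2 _ z an
  (fun _ _ => erefl) kappa ck sl zl l.
exists s; split=> // tau; rewrite ms; symmetry; exact: marked_cover_path.
Qed.

(** * Functionals on weights *)

Local Open Scope ring_scope.

Section Functionals.
Variables (R : comNzRingType) (t : R) (B l : nat).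
Hypothesis tB : t ^+ B = 0.
Implicit Types (g : nat -> int).

(* The coefficient of the empty Schur function in s_g. *)
Definition unit_coef g : R := \det (\matrix_(i < l, j < l) ((g i + j%:Z == i%:Z)%:R : R)).

(** The dot action exchanges two rows of the Jacobi-Trudi matrix. *)
Lemma unit_coef_anti p : (p.+1 < l)%N -> anti p unit_coef.
Proof.
move=> pl g; rewrite /unit_coef; set A := (X in - \det X).
pose i1 := Ordinal (ltnW pl); pose i2 := Ordinal pl.
have -> : \matrix_(i, j) (dot p g i + j%:Z == i%:Z)%:R = xrow i1 i2 A.
  apply/matrixP => i j; rewrite !mxE; congr (_%:R : R); rewrite /dot.
  case: tpermP => [->|->|/eqP n1 /eqP n2] /=.
  - by rewrite eqxx; lia.
  - by rewrite eqxx (_ : (p.+1 == p) = false); lia.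
  - by move: n1 n2; rewrite -!val_eqE /= => /negbTE -> /negbTE ->.
rewrite xrowE det_mulmx det_perm odd_tperm.
by rewrite (_ : (i1 != i2)) ?expr1 ?mulN1r // -val_eqE /= neq_ltn ltnSn.
Qed.

Lemma unit_coef_neg g : (0 < l)%N -> g l.-1 < 0 -> unit_coef g = 0.
Proof.
move=> l0 gl; have ll : (l.-1 < l)%N by rewrite prednK.
rewrite /unit_coef (expand_det_row _ (Ordinal ll)) big1 // => j _.
rewrite mxE /= (_ : (_ == _) = false) ?mul0r //.
by have := ltn_ord j; lia.
Qed.

Lemma unit_coef0 : unit_coef (fun=> 0) = 1.
Proof.
transitivity (\det (1%:M : 'M[R]_l)); last exact: det1.
by congr (\det _); apply/matrixP => i j; rewrite !mxE add0r eq_sym.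
Qed.

Definition moment g : int := \sum_(i < l) i%:Z * g i.

(* If g + rho is a permutation of rho then g has nonnegative moment. *)
Lemma unit_coef_moment g : moment g < 0 -> unit_coef g = 0.
Proof.
move=> mg; rewrite /unit_coef /determinant big1 // => s _.
have [/forallP h|] := boolP [forall i : 'I_l, g i + (s i)%:Z == i%:Z]; last first.
  rewrite negb_forall => /existsP[i hi].
  by rewrite (bigD1 i) //= mxE (negbTE hi) mul0r mulr0.
exfalso; have sq : \sum_(i < l) ((s i)%:Z ^+ 2) = \sum_(i < l) (i%:Z ^+ 2).
  by rewrite [RHS](reindex_inj (@perm_inj _ s)).
have : 0 <= \sum_(i < l) (i%:Z - (s i)%:Z) ^+ 2 by apply: sumr_ge0 => i _; exact: sqr_ge0.
have -> : \sum_(i < l) (i%:Z - (s i)%:Z) ^+ 2 = moment g *+ 2.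
  rewrite /moment -sumrMnl.
  rewrite (eq_bigr (fun i : 'I_l => (i%:Z * g i) *+ 2 + ((s i)%:Z ^+ 2 - i%:Z ^+ 2))).
    by rewrite big_split /= sumrB sq subrr addr0.
  by move=> i _; have /eqP := h i; rewrite mulr2n => <-; ring.
by move: mg; rewrite mulr2n; lia.
Qed.

Lemma moment_raise g (b : nat * nat) m : (b.1 < l)%N -> (b.2 < l)%N ->
  moment (fun x => g x + m%:Z * root b x) = moment g + m%:Z * (b.1%:Z - b.2%:Z).
Proof.
move=> b1 b2; rewrite /moment.
have one (i : nat) : (i < l)%N -> \sum_(x < l) x%:Z * eps i x = i%:Z.
  move=> il; rewrite (bigD1 (Ordinal il)) //= /eps eqxx mulr1 big1 ?addr0 // => j ji.
  by rewrite (_ : (nat_of_ord j == i) = false) ?mulr0 //; apply/negbTE; rewrite -(val_eqE _ (Ordinal il)) in ji.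
rewrite -[b.1%:Z in RHS](one _ b1) -[b.2%:Z in RHS](one _ b2) -sumrB mulr_sumr -big_split.
by apply: eq_bigr => x _; rewrite /root /=; ring.
Qed.

(** Raising along (i, j) with i < j lowers the moment, and negative moment gives 0; from moment at
    most 0 only the unraised term survives. *)
Lemma catalan_unit_coef s : (forall b, b \in s -> (b.1 < b.2 < l)%N) ->
  (forall g, moment g < 0 -> catalan t B s unit_coef g = 0) /\
  (forall g, moment g <= 0 -> catalan t B s unit_coef g = unit_coef g).
Proof.
elim: s => [|[i j] s IH] sp; first by split=> // g; exact: unit_coef_moment.
have [|z e] := IH; first by move=> c cs; apply: sp; rewrite inE cs orbT.
have /= /andP[ij jl] := sp (i, j) (mem_head _ _).
have mr g m : moment (fun x => g x + m%:Z * root (i, j) x) = moment g + m%:Z * (i%:Z - j%:Z).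
  by rewrite moment_raise //=; exact: ltn_trans jl.
have neg g : moment g < 0 -> geom t B (i, j) (catalan t B s unit_coef) g = 0.
  move=> mg; rewrite /geom big1 // => m _; rewrite z ?mulr0 // mr.
  have : m%:Z * (i%:Z - j%:Z) <= 0 by apply: mulr_ge0_le0; lia.
  by lia.
split=> //= g mg; rewrite (geom_rec tB) e // neg ?mulr0 ?addr0 //.
have -> : raise g (i, j) = (fun x => g x + 1%:Z * root (i, j) x).
  by apply/funext => x; rewrite mul1r.
by rewrite mr; lia.
Qed.

Lemma kcat_unit_coef n : (0 < n)%N -> kcat t B l n unit_coef (fun=> 0) = 1.
Proof.
move=> n0; rewrite /kcat (proj2 (catalan_unit_coef _)) ?unit_coef0 //.
  by move=> [i j]; rewrite mem_filter mem_pairs /=; lia.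
by rewrite /moment big1 // => i _; rewrite mulr0.
Qed.

(* Pairing with a product of elementary functions, one index at a time: [true]
   stands for "smaller than the previous index". *)
Fixpoint peel (cs : seq bool) (M : nat) (g : nat -> int) : R :=
  if cs is c :: cs' then \sum_(z < M) peel cs' (if c then (z : nat) else l) (lower g z)
  else unit_coef g.

Lemma lower_dot p g z : lower (dot p g) z = dot p (lower g (swap p z)).
Proof.
apply/funext => x; rewrite /lower /dot /swap /eps.
have [zp|/eqP zp] := boolP (z == p); last have [zp1|/eqP zp1] := boolP (z == p.+1).
- by repeat case: eqP => ?; subst; lia.
- by repeat case: eqP => ?; subst; lia.
- by repeat case: eqP => ?; subst; lia.
Qed.

Lemma sum_anti (f : nat -> (nat -> int) -> R) p M : M != p.+1 ->
  (forall z, z != p -> z != p.+1 -> anti p (f z)) ->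
  anti p (fun g => f p g + f p.+1 g) -> anti p (fun g => \sum_(z < M) f z g).
Proof.
move=> Mp fa fp g; elim/ltn_ind: M Mp => -[|M] IH Mp; first by rewrite !big_ord0 oppr0.
rewrite !big_ord_recr /=; have [E|Mp1] := eqVneq M p.+1.
  subst M; rewrite !big_ord_recr /= -!addrA fp IH ?opprD //; lia.
by rewrite IH ?fa ?opprD //; move: Mp; rewrite eqSS.
Qed.

(** For M different from p + 1 the sum contains both or neither of the indices p and p + 1, and the
    dot action exchanges their terms. Under a strict relation, choosing p + 1 allows one
    continuation more than choosing p, namely p itself; this extra term lowers both rows and is
    antisymmetric on its own. *)
Lemma peel_anti cs p M : (p.+1 < l)%N -> M != p.+1 -> anti p (peel cs M).
Proof.
move=> pl; move: {2}(size cs) (leqnn (size cs)) => d.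
elim: d cs M => [|d IH] [|c cs] M //= csd Mp; try exact: unit_coef_anti.
have {}IH cs' M' : (size cs' <= size cs)%N -> M' != p.+1 -> anti p (peel cs' M').
  by move=> h; apply: IH; exact: leq_trans h csd.
have sp : swap p p = p.+1 by rewrite /swap eqxx.
have sp1 : swap p p.+1 = p by rewrite /swap eqxx (_ : (p.+1 == p) = false) //; lia.
apply: (sum_anti (f := fun z g => peel cs (if c then z else l) (lower g z))) => //.
  move=> z zp zp1 g; rewrite lower_dot (_ : swap p z = z); last first.
    by rewrite /swap (negbTE zp) (negbTE zp1).
  by apply: IH => //; case: c => //; lia.
move=> g; rewrite !lower_dot sp sp1.
have pp : p != p.+1 by lia.
case: c; last first.
  have I h : peel cs l (dot p h) = - peel cs l h by apply: IH => //; lia.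
  by rewrite I I opprD addrC.
case: cs csd IH => [|c' cs] csd IH.
  have I h : peel [::] p (dot p h) = - peel [::] p h by exact: IH.
  by rewrite I [peel _ p.+1 _]I opprD addrC.
have split h : peel (c' :: cs) p.+1 h = peel (c' :: cs) p h +
    peel cs (if c' then p else l) (lower h p).
  by rewrite /= big_ord_recr.
have I h : peel (c' :: cs) p (dot p h) = - peel (c' :: cs) p h by exact: IH.
have J h : peel cs (if c' then p else l) (dot p h) = - peel cs (if c' then p else l) h.
  by apply: IH => //=; case: (c') => //; lia.
have comm : lower (lower g p) p.+1 = lower (lower g p.+1) p.
  by apply/funext => x; rewrite /lower; lia.
rewrite !split I I lower_dot sp J comm; ring.
Qed.

Lemma peel_neg cs M g : (0 < l)%N -> g l.-1 < 0 -> peel cs M g = 0.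
Proof.
move=> l0; elim: cs M g => [|c cs IH] M g gl; first exact: unit_coef_neg.
by rewrite /= big1 // => z _; apply: IH; rewrite /lower /eps; lia.
Qed.

Lemma catalan_sum s (f : nat -> (nat -> int) -> R) M g :
  catalan t B s (fun h => \sum_(z < M) f z (lower h z)) g =
  \sum_(z < M) catalan t B s (f z) (lower g z).
Proof.
elim: s g => //= b s IH g; rewrite /geom exchange_big /=; apply: eq_bigr => m _.
rewrite IH mulr_sumr; apply: eq_bigr => z _; congr (_ * catalan _ _ _ _ _).
by apply/funext => x; rewrite /lower; ring.
Qed.

Definition lower_all a g : nat -> int := fun x => g x - (x < a)%N%:Z.

Lemma catalan_lower_all s a (f : (nat -> int) -> R) g :
  catalan t B s (fun h => f (lower_all a h)) g = catalan t B s f (lower_all a g).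
Proof.
elim: s g => //= b s IH g; rewrite /geom; apply: eq_bigr => m _; rewrite IH.
by congr (_ * catalan _ _ _ _ _); apply/funext => x; rewrite /lower_all; ring.
Qed.

Lemma peel_column0 a cs M g : (M <= a)%N -> peel (nseq a true ++ false :: cs) M g = 0.
Proof.
elim: a M g => [|a IH] M g; first by rewrite leqn0 => /eqP -> /=; rewrite big_ord0.
move=> Ma; rewrite /= big1 // => z _; apply: IH.
by have := ltn_ord z; lia.
Qed.

(** A strictly decreasing sequence of a + 1 indices below a + 1 can only be a, ..., 0, so each of
    these rows is lowered exactly once. *)
Lemma peel_column a cs g :
  peel (nseq a true ++ false :: cs) a.+1 g = peel cs l (lower_all a.+1 g).
Proof.
elim: a g => [|a IH] g.
  rewrite /= big_ord1; congr peel; apply/funext => x.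
  by case: x => [|x]; rewrite /lower /lower_all /eps /=; lia.
rewrite [LHS]/= big_ord_recr big1 /= ?add0r; last first.
  by move=> z _; apply: peel_column0; have := ltn_ord z; lia.
rewrite IH; congr peel; apply/funext => x.
by rewrite /lower /lower_all /eps; lia.
Qed.

End Functionals.

(** * Chains of strong covers *)

Local Open Scope ring_scope.

Definition marked_covers (K : nat) (kappa : seq nat) (z : nat) : seq (seq nat) :=
  if pselect (is_core K.+1 kappa) is left ck then projT1 (cid (marked_covers_finite z ck))
  else [::].

Lemma marked_coversP K kappa z : is_core K.+1 kappa ->
  uniq (marked_covers K kappa z) /\
  forall tau, tau \in marked_covers K kappa z <-> strong_marked_cover K tau z kappa.
Proof. by rewrite /marked_covers; case: pselect => // ck _; case: cid. Qed.

Lemma mark_lt K tau kappa z : strong_marked_cover K tau z kappa -> (z < size kappa)%N.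
Proof.
move=> [_ [C _ /andP[+ _]]]; rewrite mem_undup => /mapP[b _ ->].
have := valP b; rewrite [val b]surjective_pairing in_fsetD !mem_diagram => /andP[_ h].
by rewrite ltnNge; apply/negP => hs; rewrite nth_default in h.
Qed.

(* Relations imposed on consecutive marks, the later one being the first
   argument. *)
Definition unconstrained : rel nat := fun _ _ => true.
Definition asc : rel nat := fun z z' => (z' < z)%N.
Definition desc : rel nat := fun z z' => (z <= z')%N.

Section ChainSums.
Variable K : nat.

(* Chains ending at kappa whose marks, read backwards, start in A and have
   consecutive entries related by cs. *)
Fixpoint chain_poly (cs : seq (rel nat)) (kappa : seq nat) (A : pred nat) : {poly int} :=
  if cs is c :: cs' then
    \sum_(0 <= z < size kappa | A z) \sum_(tau <- marked_covers K kappa z)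
      'X^(cover_spin tau kappa z) * chain_poly cs' tau (c z)
  else 1.

Definition add_cover (kappa : seq nat) (z : nat) (T : chain) : chain := (T.1, rcons T.2 (z, kappa)).

Fixpoint chains (m : nat) (kappa : seq nat) : seq chain :=
  if m is m'.+1 then
    flatten [seq flatten [seq [seq add_cover kappa z T | T <- chains m' tau]
                         | tau <- marked_covers K kappa z]
            | z <- index_iota 0 (size kappa)]
  else [:: (kappa, [::])].

Lemma strong_chain_add_cover kappa z T : strong_chain K (add_cover kappa z T) <->
  strong_chain K T /\ strong_marked_cover K (chain_end T) z kappa.
Proof.
rewrite /strong_chain /chain_end /=; case: T => T0 st /=.
suff E : strong_chain_from K T0 (rcons st (z, kappa)) <->
    strong_chain_from K T0 st /\ strong_marked_cover K (last T0 (unzip2 st)) z kappa.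
  by rewrite E; tauto.
elim: st T0 => [|[r s] st IH] T0 /=; first by tauto.
by rewrite IH; tauto.
Qed.

Lemma chain_end_add_cover kappa z T : chain_end (add_cover kappa z T) = kappa.
Proof. by rewrite /chain_end /= /unzip2 map_rcons last_rcons. Qed.

Lemma marks_add_cover kappa z T : marks (add_cover kappa z T) = rcons (marks T) z.
Proof. by rewrite /marks /= /unzip1 map_rcons. Qed.

Lemma spin_add_cover kappa z T :
  spin (add_cover kappa z T) = (spin T + cover_spin (chain_end T) kappa z)%N.
Proof.
rewrite /spin /chain_end /=; case: T => T0 st /=.
elim: st T0 => [|[r s] st IH] T0 /=; first by rewrite addnC.
by rewrite IH addnA.
Qed.

Lemma chain_cases T m : size T.2 = m.+1 ->
  exists kappa z T', T = add_cover kappa z T' /\ size T'.2 = m.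
Proof.
case: T => T0; case/lastP => //= st [z kappa]; rewrite size_rcons => -[sm].
by exists kappa, z, (T0, st).
Qed.

Lemma cover_core tau kappa z : strong_marked_cover K tau z kappa -> is_core K.+1 tau.
Proof. by move=> [[]]. Qed.

Lemma mem_chains m kappa (T : chain) : is_core K.+1 kappa ->
  T \in chains m kappa <-> [/\ strong_chain K T, size T.2 = m & chain_end T = kappa].
Proof.
elim: m kappa T => [|m IH] kappa T ck.
  rewrite inE; split=> [/eqP ->|[_ + <-]]; first by split=> //; split.
  by case: T => T0 [|].
split=> [/flattenP[s /mapP[z]]|[]].
  rewrite mem_index_iota => zk ->.
  move=> /flattenP[s' /mapP[tau]] tz -> /mapP[T' T'c ->].
  have sc := (proj2 (marked_coversP z ck) tau).1 tz.
  have [sT sz eT] := (IH tau T' (cover_core sc)).1 T'c.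
  split; rewrite ?chain_end_add_cover //=; last by rewrite size_rcons sz.
  by apply/strong_chain_add_cover; rewrite eT.
move=> scT /chain_cases[kappa' [z [T' [E sz]]]]; rewrite E chain_end_add_cover => kk; subst kappa'.
move: scT; rewrite E => /strong_chain_add_cover[scT sc].
apply/flattenP; eexists.
  by apply/mapP; exists z; [rewrite mem_index_iota /=; exact: mark_lt sc|reflexivity].
apply/flattenP; eexists.
  by apply/mapP; exists (chain_end T'); [apply/(proj2 (marked_coversP z ck))|reflexivity].
by apply/map_f/IH => //; exact: cover_core sc.
Qed.

Lemma uniq_flatten_map (S U : eqType) (s : seq S) (f : S -> seq U) : uniq s ->
  (forall x, x \in s -> uniq (f x)) ->
  (forall x y u, x \in s -> y \in s -> u \in f x -> u \in f y -> x = y) ->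
  uniq (flatten [seq f x | x <- s]).
Proof.
elim: s => //= a s IH /andP[as_ us] uf disj.
rewrite cat_uniq uf ?mem_head //= IH //; last first.
- by move=> x y u xs ys; apply: disj; rewrite inE ?xs ?ys orbT.
- by move=> x xs; apply: uf; rewrite inE xs orbT.
rewrite andbT; apply/hasPn => u /flattenP[_ /mapP[x xs ->]] ux; apply/negP => ua.
have := disj a x u (mem_head _ _) _ ua ux; rewrite inE xs orbT => /(_ isT) E.
by rewrite -E (negbTE as_) in xs.
Qed.

Lemma add_cover_inj kappa kappa' z z' T T' : add_cover kappa z T = add_cover kappa' z' T' -> z = z' /\ T = T'.
Proof.
case: T T' => T0 st [T0' st'] []; rewrite /= => -> /rcons_inj[-> -> _]; by [].
Qed.

Lemma chains_uniq m kappa : is_core K.+1 kappa -> uniq (chains m kappa).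
Proof.
elim: m kappa => //= m IH kappa ck; apply: uniq_flatten_map; first exact: iota_uniq.
  move=> z _; have [us ms] := marked_coversP z ck; apply: uniq_flatten_map => //.
    move=> tau /ms/cover_core ct; rewrite map_inj_uniq ?IH // => T T'.
    by move=> /add_cover_inj[].
  move=> tau tau' u /ms/cover_core ct /ms/cover_core ct' /mapP[T Tc ->] /mapP[T' Tc' /add_cover_inj[_ E]].
  have [_ _ <-] := (mem_chains m T ct).1 Tc; rewrite E.
  by have [_ _ <-] := (mem_chains m T' ct').1 Tc'.
move=> z z' u _ _ /flattenP[_ /mapP[tau _ ->]] /mapP[T _ ->].
by move=> /flattenP[_ /mapP[tau' _ ->]] /mapP[T' _ /add_cover_inj[]].
Qed.

Lemma chains_length m kappa (T : chain) : is_core K.+1 kappa -> T \in chains m kappa ->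
  is_core K.+1 T.1 /\ (sumn (pcore K T.1) + m = sumn (pcore K kappa))%N.
Proof.
move=> ck /(mem_chains m T ck)[]; elim: m kappa T ck => [|m IH] kappa T ck scT sz eT.
  case: T scT sz eT => T0 [|//] [] /= cT _ _ <-; by rewrite addn0.
have [kappa' [z [T' [E sz']]]] := chain_cases sz; subst T.
have [scT' sc] := (strong_chain_add_cover _ _ _).1 scT.
move: eT; rewrite chain_end_add_cover => kk; subst kappa'.
have [cT sT] := IH _ T' (cover_core sc) scT' sz' erefl; split=> //=.
by have [[_ _ _ <-] _] := sc; rewrite addnS sT.
Qed.

Fixpoint related (cs : seq (rel nat)) (A : pred nat) (w : seq nat) : bool :=
  match cs, w with
  | c :: cs', z :: w' => A z && related cs' (c z) w'
  | [::], [::] => true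
  | _, _ => false
  end.

Fixpoint next (cs : seq (rel nat)) (A : pred nat) (w : seq nat) : pred nat :=
  match cs, w with
  | c :: cs', z :: w' => next cs' (c z) w'
  | _, _ => A
  end.

Lemma chain_poly_cat cs1 cs2 kappa A : is_core K.+1 kappa -> chain_poly (cs1 ++ cs2) kappa A =
  \sum_(T <- chains (size cs1) kappa | related cs1 A (rev (marks T)))
    'X^(spin T) * chain_poly cs2 T.1 (next cs1 A (rev (marks T))).
Proof.
elim: cs1 kappa A => [|c cs1 IH] kappa A ck.
  by rewrite big_mkcond big_seq1 /= expr0 mul1r.
rewrite [RHS]big_mkcond /= big_flatten big_map [LHS]big_mkcond /=; apply: eq_bigr => z _.
rewrite big_flatten big_map /=.
have [Az|nAz] := boolP (A z); last first.
  rewrite big1 // => tau _; rewrite big_map big1 // => T _.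
  by rewrite marks_add_cover rev_rcons /= (negbTE nAz).
rewrite big_seq [RHS]big_seq; apply: eq_bigr => tau /(proj2 (marked_coversP z ck)) sc.
have ct := cover_core sc.
rewrite IH // mulr_sumr big_map [LHS]big_mkcond /=.
rewrite big_seq [RHS]big_seq; apply: eq_bigr => T /(mem_chains _ _ ct)[_ _ eT].
rewrite marks_add_cover rev_rcons /= Az /= spin_add_cover eT; case: ifP => // _.
by rewrite mulrA -exprD addnC.
Qed.

End ChainSums.

(** * Branching for weighted sums of chains *)

Local Open Scope ring_scope.

Lemma nth_le_sumn s r : (nth 0 s r <= sumn s)%N.
Proof.
elim: s r => [|a s IH] [|r] //=; first exact: leq_addr.
by apply: leq_trans (IH r) _; exact: leq_addl.
Qed.

Lemma size_part_le s s' : is_part s -> (forall r, nth 0 s r <= nth 0 s' r)%N ->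
  (size s <= size s')%N.
Proof.
move=> /andP[_ n0] le; rewrite leqNgt; apply/negP => h.
have := mem_nth 0%N h; have := le (size s'); rewrite [X in (_ <= X)%N]nth_default // leqn0.
by move=> /eqP ->; rewrite (negbTE n0).
Qed.

Definition rel_of (c : bool) : rel nat := if c then asc else unconstrained.

Section Algebra.
Variables (R : comNzRingType) (t : R) (B l K : nat).
Hypothesis tB : t ^+ B = 0.
Hypothesis no2 : forall x : R, x + x = 0 -> x = 0.
Hypothesis l0 : (0 < l)%N.
Variable h : {rmorphism {poly int} -> R}.
Hypothesis hX : h 'X = t.

(** Induction on the number of covers: by [marked_cover_sum], removing the last cover of the chain
    is one lowering in [peel]. The bound M is the constraint left by the mark just removed; l means
    none, as all marks are smaller than [size kappa]. *)
Lemma chain_poly_peel cs kappa M (A : pred nat) : is_core K.+1 kappa -> (size kappa <= l)%N ->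
  sumn (pcore K kappa) = size cs -> (M <= l)%N ->
  (forall z, (z < l)%N -> A z = (z < M)%N) ->
  h (chain_poly K (map rel_of cs) kappa A) =
  kcat t B l K.+1 (peel R l cs M) (fun r => (nth 0%N (pcore K kappa) r)%:Z).
Proof.
elim: cs kappa M A => [|c cs IH] kappa M A ck sk sumk Ml AM.
  rewrite /= rmorph1 -[1](@kcat_unit_coef _ t B l tB K.+1) //; congr kcat.
  apply/funext => r; have := nth_le_sumn (pcore K kappa) r.
  by rewrite sumk leqn0 => /eqP ->.
rewrite /kcat (catalan_sum _ _ _ (fun z => peel R l cs (if c then z else l))).
pose G z := \sum_(tau <- marked_covers K kappa z)
  t ^+ cover_spin tau kappa z * h (chain_poly K (map rel_of cs) tau (rel_of c z)).
have G0 z : (size kappa <= z)%N -> G z = 0.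
  move=> kz; rewrite /G big_seq big1 // => tau /(proj2 (marked_coversP z ck))/mark_lt; lia.
transitivity (\sum_(0 <= z < size kappa | A z) G z).
  rewrite rmorph_sum; apply: eq_bigr => z _; rewrite rmorph_sum; apply: eq_bigr => tau _.
  by rewrite rmorphM rmorphXn hX.
have -> : \sum_(0 <= z < size kappa | A z) G z = \sum_(0 <= z < l | A z) G z.
  rewrite [RHS](big_cat_nat (n := size kappa)) //=.
  rewrite [X in _ = _ + X]big_nat_cond [X in _ = _ + X]big1 ?addr0 // => z /andP[/andP[+ _] _].
  exact: G0.
rewrite -(big_mkord xpredT (fun z => catalan t B _ (peel R l cs (if c then z else l)) (lower _ z))).
rewrite (big_nat_widen _ _ _ _ _ Ml) [LHS]big_nat_cond [RHS]big_nat_cond; apply: eq_big => [z|z].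
  by have [/andP[_ zl]|] := boolP (0 <= z < l)%N; rewrite /= ?AM.
move=> /andP[/andP[_ zl] Az]; have [us ms] := marked_coversP z ck.
rewrite (marked_cover_sum tB no2 _ _ ck sk zl us ms).
- rewrite /G big_seq [RHS]big_seq; apply: eq_bigr => tau /ms sc; congr (_ * _).
  have [sc' _] := sc; have [ct _ _ sums] := sc'.
  apply: IH => //.
  + apply: leq_trans sk; apply: size_part_le; first by case: ct.
    exact: strong_cover_le sc'.
  + by move: sums; rewrite sumk => -[].
  + by case: (c); [exact: ltnW|].
  + by move=> z' z'l; case: (c); rewrite /rel_of /asc /unconstrained ?z'l.
- by move=> p pl pz; apply: peel_anti => //; case: (c) => //; [rewrite eq_sym|lia].
- by move=> g; apply: peel_neg.
Qed.

End Algebra.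

(** Applied to Z[t]/(t^B) with B above both sizes: there t is nilpotent, 2-torsion is absent, and
    small polynomials are determined by their classes. *)
Lemma poly_eq_mod (p q : {poly int}) : (forall (R : comNzRingType) (t : R) (B : nat),
    t ^+ B = 0 -> (forall x : R, x + x = 0 -> x = 0) ->
    forall h : {rmorphism {poly int} -> R}, h 'X = t -> h p = h q) -> p = q.
Proof.
move=> H; pose B := (maxn (size p) (size q)).+2.
pose R := {poly %/ ('X^B : {poly int})}.
have mm : mk_monic ('X^B : {poly int}) = 'X^B.
  by rewrite /mk_monic size_polyXn monicXn.
have small (r : {poly int}) : (size r <= B)%N -> (in_qpoly 'X^B r : {poly int}) = r.
  by move=> rB; apply: in_qpoly_small; rewrite mm size_polyXn.
have XB : (in_qpoly 'X^B 'X : R) ^+ B = 0.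
  rewrite -rmorphXn /=; apply: val_inj; rewrite /= mm.
  exact: Pdiv.RingMonic.rmodpp (monicXn _ _).
have no2 (x : R) : x + x = 0 -> x = 0.
  move=> /(congr1 (fun y : R => (y : {poly int}))) /= E; apply: val_inj => /=.
  apply/polyP => i; have /(congr1 (fun y : {poly int} => y`_i)) := E.
  have aux (a : int) : a + a = 0 -> a = 0 by lia.
  by rewrite /= coefD !coef0; exact: aux.
have E := H R _ B XB no2 (in_qpoly 'X^B) erefl.
rewrite -(small p); last by rewrite /B; lia.
by rewrite E small // /B; lia.
Qed.

Section BranchingPoly.
Variables (k l : nat) (kappa kappa' : seq nat).
Hypothesis l0 : (0 < l)%N.
Hypothesis ck : is_core k.+1 kappa.
Hypothesis ck' : is_core k.+2 kappa'.
Hypothesis sk : (size kappa <= l)%N.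
Hypothesis sk' : (size kappa' <= l)%N.
Hypothesis shift : forall r, (r < l)%N -> nth 0%N (pcore k.+1 kappa') r = (nth 0%N (pcore k kappa) r).+1.

Lemma sumn_shift : sumn (pcore k.+1 kappa') = (sumn (pcore k kappa) + l)%N.
Proof.
rewrite (@sumn_nth _ l) ?(@sumn_nth (pcore k kappa) l) ?size_map ?size_iota //.
rewrite (eq_bigr (fun r : 'I_l => (nth 0%N (pcore k kappa) r + 1)%N)) => [|r _].
  by rewrite big_split /= sum1_card card_ord.
by rewrite shift // addn1.
Qed.

(** Marks are read from the end of the chain, so the vertical tableau comes first: l - 1 strict
    relations, then a free one towards the last mark of the strong tableau preceding it. *)
Definition column : seq bool := rcons (nseq l.-1 true) false.

Lemma branching_bool cs : size cs = sumn (pcore k kappa) ->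
  chain_poly k (map rel_of cs) kappa predT =
  chain_poly k.+1 (map rel_of (column ++ cs)) kappa' predT.
Proof.
move=> scs; apply: poly_eq_mod => R t B tB no2 h hX.
rewrite (@chain_poly_peel R t B l k tB no2 l0 h hX cs kappa l) //.
rewrite (@chain_poly_peel R t B l k.+1 tB no2 l0 h hX (column ++ cs) kappa' l) //; last first.
  by rewrite sumn_shift size_cat size_rcons size_nseq prednK // -scs addnC.
have -> : peel R l (column ++ cs) l = fun g => peel R l cs l (lower_all l g).
  apply/funext => g; rewrite /column cat_rcons; case: (l) l0 => // a _.
  exact: peel_column.
rewrite /kcat catalan_lower_all.
have -> : lower_all l (fun r => (nth 0%N (pcore k.+1 kappa') r)%:Z) =
    (fun r => (nth 0%N (pcore k kappa) r)%:Z).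
  apply/funext => r; rewrite /lower_all; have [rl|lr] := ltnP r l; first by rewrite shift //; lia.
  by rewrite !nth_default ?size_map ?size_iota //; lia.
congr (catalan t B _ _ _); apply: eq_in_filter => -[i j]; rewrite mem_pairs => /andP[il _] /=.
by rewrite shift //; lia.
Qed.

(* [None] stands for the negation of [Some true]. *)
Definition rel_of3 (c : option bool) : rel nat := if c is Some b then rel_of b else desc.

Lemma chain_poly_last K pre c A s :
  chain_poly K (pre ++ [:: c]) s A = chain_poly K (pre ++ [:: unconstrained]) s A.
Proof.
elim: pre A s => [|d pre IH] A s //=.
by apply: eq_bigr => z _; apply: eq_bigr => tau _; rewrite IH.
Qed.

(** The entry c after the relation guarantees that there is a further mark to compare with; a
    relation in last position constrains nothing. *)
Lemma chain_poly_desc K pre c cs A s :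
  chain_poly K (pre ++ desc :: c :: cs) s A =
  chain_poly K (pre ++ unconstrained :: c :: cs) s A - chain_poly K (pre ++ asc :: c :: cs) s A.
Proof.
elim: pre A s => [|d pre IH] A s; rewrite /= -sumrB; apply: eq_bigr => z _;
  rewrite -sumrB; apply: eq_bigr => tau _; rewrite -mulrBr; congr (_ * _); last exact: IH.
rewrite (bigID (asc z) (unconstrained z)) /= /unconstrained addrC addrK; apply: eq_bigl => z'.
by rewrite /desc /asc; lia.
Qed.

Lemma branching_poly cs : size cs = sumn (pcore k kappa) ->
  chain_poly k (map rel_of3 cs) kappa predT =
  chain_poly k.+1 (map rel_of column ++ map rel_of3 cs) kappa' predT.
Proof.
(* Each [None] is expanded as a free minus an increasing relation; entries already made boolean are
   collected in [pre]. *)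
suff gen pre : (size pre + size cs)%N = sumn (pcore k kappa) ->
    chain_poly k (map rel_of pre ++ map rel_of3 cs) kappa predT =
    chain_poly k.+1 (map rel_of (column ++ pre) ++ map rel_of3 cs) kappa' predT.
  by move=> h; have := gen [::] h; rewrite cats0.
elim: cs pre => [|c cs IH] pre.
  by rewrite addn0 !cats0; exact: branching_bool.
have step b : (size pre + (size cs).+1)%N = sumn (pcore k kappa) ->
    chain_poly k (map rel_of pre ++ rel_of b :: map rel_of3 cs) kappa predT =
    chain_poly k.+1 (map rel_of (column ++ pre) ++ rel_of b :: map rel_of3 cs) kappa' predT.
  move=> h; have := IH (rcons pre b).
  by rewrite size_rcons addSnnS => /(_ h); rewrite -!cats1 catA !map_cat -!catA.
move=> h; have sf := step false h; have sa := step true h.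
case: c h => [b|] h /=; first exact: step.
case: cs sf sa {h IH step} => [|c cs] sf sa.
  by rewrite /= (chain_poly_last _ _ desc) [RHS](chain_poly_last _ _ desc).
by rewrite /= !chain_poly_desc; congr (_ - _).
Qed.

End BranchingPoly.

(** * Tableaux *)

Local Open Scope ring_scope.

Lemma relatedP cs (A : pred nat) w : related cs A w <->
  [/\ size w = size cs, (0 < size w)%N -> A (nth 0%N w 0) &
      forall i, (i.+1 < size w)%N -> nth unconstrained cs i (nth 0%N w i) (nth 0%N w i.+1)].
Proof.
elim: cs A w => [|c cs IH] A [|z w] /=; try by split=> [//|[]].
split=> [/andP[Az /IH[sw w0 wi]]|[[sw] Az wi]].
  split; [by rewrite sw|by []|move=> [|i]; [exact: w0|exact: wi]].
rewrite Az //=; apply/IH; split=> // [w0|i iw]; first exact: (wi 0%N w0).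
exact: (wi i.+1).
Qed.

Lemma next_unconstrained cs A w : size w = (size cs).+1 -> next (rcons cs unconstrained) A w = predT.
Proof. by elim: cs A w => [|c cs IH] A [|z w] //= [sw]; exact: IH. Qed.

Definition same_block (eta : weight) (q : nat) : Prop :=
  exists i : nat, (\sum_(j < i) eta j <= q)%N /\ (q.+1 < \sum_(j < i) eta j + eta i)%N.

Lemma mark_blockP (ord : rel nat) eta T :
  (forall i, sorted ord (mark_block eta T i)) <->
  (forall q, (q.+1 < size (marks T))%N -> same_block eta q ->
     ord (nth 0%N (marks T) q) (nth 0%N (marks T) q.+1)).
Proof.
rewrite /mark_block; split=> [h q qm [i [vq qv]]|h i].
  have /(sortedP 0%N)/(_ (q - \sum_(j < i) eta j)%N) := h i.
  rewrite !nth_take ?nth_drop ?size_take_min ?size_drop; [|lia|lia].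
  by rewrite addnS subnKC //; apply; lia.
apply/(sortedP 0%N) => q; rewrite size_take_min size_drop => hq.
rewrite !nth_take ?nth_drop; [|lia|lia].
by rewrite addnS; apply: h; [lia|exists i; lia].
Qed.

Lemma strong_chain_end K T : strong_chain K T -> is_core K.+1 (chain_end T).
Proof.
case E : (size T.2) => [|m].
  by case: T E => T0 [|//] _ [].
have [kappa [z [T' [-> _]]]] := chain_cases E.
by rewrite chain_end_add_cover => /strong_chain_add_cover[_ [[]]].
Qed.

Section Tableaux.
Variables (K : nat) (eta : weight) (sigma mu : seq nat) (ord : rel nat) (cs : seq (rel nat)).
Hypothesis csigma : is_core K.+1 sigma.
Hypothesis pad : eq_pad (pcore K sigma) mu.
Hypothesis size_cs : size cs = wsize eta.
Hypothesis ord_cs : forall i q z z', (i + q.+2)%N = size cs ->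
  nth unconstrained cs i z z' <-> (same_block eta q -> ord z' z).

Lemma tableaux_chains : marked_tableaux ord K eta mu =
  [set` [seq T <- chains K (size cs) sigma | related cs predT (rev (marks T))]]%classic.
Proof.
apply/seteqP; split=> T /=; rewrite mem_filter.
  move=> [scT sm bl ep].
  have eT : chain_end T = sigma.
    by apply: (core_inj (strong_chain_end scT) csigma) => r; rewrite ep pad.
  apply/andP; split; last by apply/mem_chains; rewrite // size_cs -sm size_map.
  apply/relatedP; rewrite size_rev sm size_cs; split=> // i im.
  rewrite !nth_rev ?sm ?size_cs //; last exact: ltnW.
  apply/(ord_cs (q := (wsize eta - i.+2)%N)); first by rewrite size_cs; lia.
  have -> : (wsize eta - i.+1 = (wsize eta - i.+2).+1)%N by lia.
  by apply: (mark_blockP _ _ _).1 => //; lia.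
move=> /andP[/relatedP[sm _ rel] /(mem_chains _ _ csigma)[scT sT eT]].
rewrite size_rev in sm rel; split=> //; first by rewrite sm.
  apply/mark_blockP => q qm sb.
  have := rel (size (marks T) - q.+2)%N; rewrite !nth_rev; try lia.
  have -> : (size (marks T) - (size (marks T) - q.+2).+1 = q.+1)%N by lia.
  have -> : (size (marks T) - (size (marks T) - q.+2).+2 = q)%N by lia.
  have iq : ((size (marks T) - q.+2) + q.+2)%N = size cs by rewrite -sm; lia.
  by move=> r; have := (ord_cs _ _ iq).1 (r ltac:(lia)) sb.
by rewrite eT.
Qed.

Lemma tableaux_uniq :
  uniq [seq T <- chains K (size cs) sigma | related cs predT (rev (marks T))].
Proof. by rewrite filter_uniq // chains_uniq. Qed.

End Tableaux.

(** Read from the end: entry i compares the marks numbered wsize eta - i - 1 and wsize eta - i - 2.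
    In the last entry the truncated subtraction gives 0, without effect since there is no further
    mark to compare with. *)
Definition descents (eta : weight) : seq (option bool) :=
  mkseq (fun i => if `[< same_block eta (wsize eta - i.+2) >] then None else Some false)
    (wsize eta).

Lemma SMT_chain_poly K eta sigma mu : is_core K.+1 sigma -> eq_pad (pcore K sigma) mu ->
  \sum_(T \in SMT K eta mu) ('X^(spin T) : {poly int}) =
  chain_poly K (map rel_of3 (descents eta)) sigma predT.
Proof.
move=> cs pad; have sz : size (map rel_of3 (descents eta)) = wsize eta.
  by rewrite size_map size_mkseq.
rewrite /SMT (tableaux_chains cs pad sz) => [|i q z z'].
  rewrite -fsbig_seq ?tableaux_uniq // big_filter.
  rewrite -[map _ _]cats0 chain_poly_cat // cats0.
  by apply: eq_bigr => T _; rewrite mulr1.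
rewrite sz => iq; rewrite (nth_map None) ?size_mkseq; last by lia.
rewrite nth_mkseq; last by lia.
have -> : (wsize eta - i.+2 = q)%N by lia.
case: asboolP => sb; last by rewrite /= /rel_of /unconstrained; split.
by rewrite /= /desc; split=> [h _|/(_ sb)].
Qed.

Lemma wsize_single l : (0 < l)%N -> wsize (single_weight l) = l.
Proof.
move=> l0; rewrite /wsize (_ : finsupp _ = [fset 0]%fset).
  by rewrite big_seq_fset1 fsfunE inE eqxx.
by apply/fsetP => i; rewrite mem_finsupp fsfunE !inE; case: (i == 0%N); rewrite // -lt0n.
Qed.

Lemma VSMT_chains K l sigma mu : (0 < l)%N -> is_core K.+1 sigma -> eq_pad (pcore K sigma) mu ->
  VSMT K (single_weight l) mu =
  [set` [seq T <- chains K l sigma | related (map rel_of (column l)) predT (rev (marks T))]]%classic.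
Proof.
move=> l0 cs pad; have sz : size (map rel_of (column l)) = l.
  by rewrite size_map size_rcons size_nseq prednK.
rewrite -{3}sz; apply: tableaux_chains => //; first by rewrite sz wsize_single.
move=> i q z z'; rewrite sz => iq; rewrite (nth_map false) ?size_rcons ?size_nseq; last by lia.
rewrite nth_rcons size_nseq nth_nseq; have -> : (i < l.-1)%N by lia.
rewrite /rel_of /asc; split=> [//|]; apply; exists 0%N; rewrite big_ord0.
split=> //; rewrite /single_weight fsfunE inE eqxx; lia.
Qed.

Lemma scale_series (a : {poly int}) (f : power_series) eta : (a *: f) eta = a * f eta.
Proof. by []. Qed.

Theorem theorem2p6 (k l : nat) (mu : seq nat)
  (hk : (0 < k)%N) (hl : (0 < l)%N) (hmu : Par k l mu) :
  kSchur k mu =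
  \sum_(T \in VSMT k.+1 (single_weight l) [seq x.+1 | x <- mu])
     'X^(spin T) *: kSchur k.+1 (inside k.+1 T).
Proof.
have /and3P[/eqP smu /allP mu_le mu_sorted] := hmu.
have mu_mono i j : (i <= j)%N -> (nth 0%N mu j <= nth 0%N mu i)%N.
  move=> ij; have [jl|lj] := ltnP j l; last by rewrite (nth_default _ (_ : size mu <= j)%N) ?smu.
  have trg : transitive geq by move=> a b c /= ba cb; exact: leq_trans cb ba.
  by apply: (sorted_leq_nth trg leqnn 0%N mu_sorted) => //; rewrite inE; lia.
have mu_k r : (nth 0%N mu r <= k)%N.
  have [rl|lr] := ltnP r l; last by rewrite nth_default ?smu.
  by apply: mu_le; apply: mem_nth; rewrite smu.
have nth_mu' r : nth 0%N [seq x.+1 | x <- mu] r = if (r < l)%N then (nth 0%N mu r).+1 else 0%N.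
  case: ltnP => h; first by rewrite (nth_map 0%N) ?smu.
  by rewrite nth_default // size_map smu.
have [kappa ck pk] := @core_exists k (nth 0%N mu) l mu_mono mu_k
  (fun r h => nth_default 0%N (eq_ind_r (fun n => n <= r)%N h smu)).
have [||r lr|kappa' ck' pk'] := @core_exists k.+1 (nth 0%N [seq x.+1 | x <- mu]) l.
- by move=> i j ij; rewrite !nth_mu'; have := mu_mono _ _ ij; case: ifP; case: ifP; lia.
- by move=> r; rewrite nth_mu'; have := mu_k r; case: ifP; lia.
- by rewrite nth_mu' ltnNge lr.
have sk : (size kappa <= l)%N by apply: (core_size ck) => r lr; rewrite pk nth_default ?smu.
have sk' : (size kappa' <= l)%N.
  by apply: (core_size ck') => r lr; rewrite pk' nth_mu' ltnNge lr.
have shift r : (r < l)%N -> nth 0%N (pcore k.+1 kappa') r = (nth 0%N (pcore k kappa) r).+1.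
  by move=> rl; rewrite pk' pk nth_mu' rl.
have sumk : sumn (pcore k kappa) = sumn mu.
  rewrite (@sumn_nth _ l) ?size_map ?size_iota // (@sumn_nth mu l) ?smu //.
  by apply: eq_bigr => r _; rewrite pk.
have sumk' := sumn_shift sk sk' shift.
have sum_inside (T : chain) : T \in chains k.+1 l kappa' -> sumn (inside k.+1 T) = sumn mu.
  by move=> /(chains_length ck')[_ sT]; rewrite /inside; lia.
rewrite (VSMT_chains hl ck' pk') -fsbig_seq ?filter_uniq ?chains_uniq //.
apply/funext => eta; rewrite fct_sumE.
(* For a weight of the wrong size both sides vanish: each T consists of l covers, so its inside has
   the size of mu. *)
rewrite {1}/kSchur; case: eqP => [we|we]; last first.
  rewrite big_seq big1 // => T; rewrite mem_filter => /andP[_ Tc].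
  rewrite scale_series /kSchur ifF ?mulr0 //; apply/eqP => E; apply: we.
  by rewrite E; exact: sum_inside.
rewrite (SMT_chain_poly _ ck pk) (branching_poly hl ck ck' sk sk' shift); last first.
  by rewrite size_mkseq we sumk.
rewrite chain_poly_cat // size_map size_rcons size_nseq prednK // big_filter.
rewrite big_seq_cond [RHS]big_seq_cond; apply: eq_bigr => T /andP[Tc rel].
have [cT _] := chains_length ck' Tc.
have [_ szT _] := (mem_chains _ _ ck').1 Tc.
have szm : size (marks T) = l by rewrite size_map; exact: szT.
rewrite scale_series /kSchur ifT; last by apply/eqP; rewrite we; apply/esym/sum_inside.
(* The last relation of [column] is free, so the vertical tableau imposes nothing on the marks of
   the strong tableau below it. *)
rewrite map_rcons next_unconstrained; last by rewrite size_rev szm size_map size_nseq prednK.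
by rewrite (SMT_chain_poly _ cT).
Qed.
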